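(* Let $q$ be a prime power, $m\geq5$, $F=\mathbb{F}_{q^m}$, $\ell\geq3$, $A=(\alpha_1,\ldots,\alpha_\ell)\in(F^* )^\ell$, and let $0<I<J<m$ be integers with $\gcd(I,J)=1$; put $K=J-I$. Suppose that $\kappa_A^{I,J}$ is not a $C_{K,\ell}$-th power in $F$ and that there exists $\delta\in\{1,\ldots,\ell-1\}$ such that $\Pi_{\delta+2}/\Pi_2$ is not a $(q^{\ell K}-1)$-st power in $F$. Let $s$ be an integer with $1\leq s<(m-2)/2$, let $B\leq F$ be an $s$-dimensional $\mathbb{F}_q$-subspace, and let $H_{A,B}$, $G_{A,B}$ be as in the context. Then the columns of $G_{A,B}$ span over $\mathbb{F}_q$ an extremal $(m-3)$-scattered $[\ell m+s,\ell(m-2)+s]_{q^m/q}$ $q$-system. Let $D$ be the $F$-row space of $H_{A,B}$. Then $D$ is the dual of the code associated with the constructed $q$-system and satisfies $$d_2(D)\geq2m-2J.$$ If $$m-2J>\left\lfloor\frac{s}{\ell}\right\rfloor,$$ then the system is inequivalent to every $q$-system associated with $D_{\mathbf{s}}^\perp$, where $\mathbf{s}$ has $\ell$ nonnegative integer entries with sum $s$ and $D_{\mathbf{s}}$ is an order-one direct-sum code.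
   Context: Notation. Subscripts of the $\alpha_i$ and $\Pi_i$ are read cyclically modulo $\ell$. Put $C_{a,r}=\frac{q^{ar}-1}{q^a-1}$, $$\kappa_A^{I,J}=\frac{\alpha_1^{q^{(\ell-2)K}}\prod_{u=3}^{\ell}\alpha_u^{q^{(u-3)K}}}{\alpha_2^{C_{K,\ell-1}}},\qquad \Pi_i=\alpha_i^{q^{(\ell-1)K}}\alpha_{i-1}^{q^{(\ell-2)K}}\cdots\alpha_{i+2}^{q^K}\alpha_{i+1}=\prod_{j=0}^{\ell-1}\alpha_{i-j}^{q^{(\ell-1-j)K}}.$$ For a positive integer $t$, $c\in F^*$ is a $t$-th power in $F$ if $c=v^t$ for some $v\in F^*$. For $x=(x_1,\ldots,x_\ell)\in F^\ell$ let $f_i(x)=x_i^{q^I}+\alpha_{i+1}x_{i+1}^{q^J}$ for $1\leq i<\ell$ and $f_\ell(x)=x_\ell^{q^I}+\alpha_1x_1^{q^J}$, and $$W_A^{I,J}=\{(x_1,\ldots,x_\ell,f_1(x),\ldots,f_\ell(x)):x\in F^\ell\}\leq F^{2\ell}.$$ Let $H_0\in F^{2\ell\times\ell m}$ have as columns an $\mathbb{F}_q$-basis of $W_A^{I,J}$. Let $b_1,\ldots,b_s$ be an $\mathbb{F}_q$-basis of $B$ and let $Z_B\in F^{2\ell\times s}$ have columns $(0,\ldots,0,b_j,0,\ldots,0)^\top$ with $b_j$ in position $\ell+1$ (the position of $f_1$). Put $H_{A,B}=[H_0\mid Z_B]$, and let $G_{A,B}$ be any generator matrix of the dual of the $F$-row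 space of $H_{A,B}$. Systems. An $[n,k]_{q^m/q}$ $q$-system is an $n$-dimensional $\mathbb{F}_q$-subspace $U\leq F^k$ with $\langle U\rangle_F=F^k$. It is $h$-scattered if $\dim_{\mathbb{F}_q}(U\cap H)\leq h$ for every $h$-dimensional $F$-subspace $H\leq F^k$, and then extremal if $n=\lfloor km/(h+1)\rfloor$. Two systems in $F^k$ are equivalent if $U'=M(\sigma(U))$ with $M\in\operatorname{GL}(k,F)$, $\sigma\in\operatorname{Aut}(F)$ (full field automorphism group). Codes. An $[n,r]_{q^m/q}$ code is an $r$-dimensional $F$-subspace $C\leq F^n$. The rank weight of $x\in F^n$ is the $\mathbb{F}_q$-dimension of the span of its coordinates; $d(C)$ is the minimum rank weight of a nonzero word, and $[n,r,d]_{q^m/q}$ means $d(C)=d$. $C^\perp=\{y: xy^\top=0\ \forall x\in C\}$. A code is nondegenerate if the columns of a generator matrix are $\mathbb{F}_q$-independent; the $\mathbb{F}_q$-span of the columns is then a $q$-system, and code and system are called associated. Expanding $x\in F^n$ over an $\mathbb{F}_q$-basis of $F$ as an $m\times n$ matrix, $\operatorname{Rsupp}_q(x)$ is its row space; $\operatorname{Rsupp}_q(V)$ is the sum of supports of an $F$-basis of $V$; $d_2(C)=\min\{\dim_{\mathbb{F}_q}\operatorname{Rsupp}_q(V): V\leq C,\dim_FV=2\}$. For nonnegative integers $\mathbf{s}=(s_1,\ldots,s_\ell)$ with sum $s$, an order-one direct-sum code is $D_{\mathbf{s}}=D_{s_1}\oplus\cdots\oplus D_{s_\ell}$ on disjoint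 coordinate blocks, where each $D_{s_i}$ is any nondegenerate $[m+s_i,2,m-1]_{q^m/q}$ code. *)

(* Defs.v *)
From HB Require Import structures.
From mathcomp Require Import all_boot all_order all_fingroup all_algebra.
From mathcomp Require Import all_solvable all_field.

Set Implicit Arguments.
Unset Strict Implicit.
Unset Printing Implicit Defensive.
Import GRing.Theory VectorInternalTheory.
Local Open Scope ring_scope.

(* Fq is the field with q = #|Fq| elements, F an extension of degree
   m = \dim {:F}.  F-subspaces of F^n (codes in particular) are row spaces of
   matrices, compared with %MS; F_q-subspaces of F^k are {vspace qvec F k}. *)

(* F^k with scalars restricted to the base field. *)
Definition qvec (Fq : fieldType) (F : fieldExtType Fq) (k : nat) : Type :=
  'rV[F]_k.

HB.instance Definition _ (Fq : fieldType) (F : fieldExtType Fq) (k : nat) :=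
  GRing.Zmodule.on (qvec F k).

Definition qvec_scale (Fq : fieldType) (F : fieldExtType Fq) (k : nat)
  (a : Fq) (v : qvec F k) : qvec F k := a%:A *: (v : 'rV[F]_k).

Fact qvec_scaleA (Fq : fieldType) (F : fieldExtType Fq) (k : nat)
  (a b : Fq) (v : qvec F k) :
  qvec_scale a (qvec_scale b v) = qvec_scale (a * b) v.
Proof. by rewrite /qvec_scale scalerA -in_algE -rmorphM. Qed.

Fact qvec_scale1 (Fq : fieldType) (F : fieldExtType Fq) (k : nat) :
  left_id 1 (@qvec_scale Fq F k).
Proof. by move=> v; rewrite /qvec_scale scale1r scale1r. Qed.

Fact qvec_scaleDr (Fq : fieldType) (F : fieldExtType Fq) (k : nat) :
  right_distributive (@qvec_scale Fq F k) +%R.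
Proof. by move=> a u v; apply: scalerDr. Qed.

Fact qvec_scaleDl (Fq : fieldType) (F : fieldExtType Fq) (k : nat)
  (v : qvec F k) : {morph (@qvec_scale Fq F k)^~ v : a b / a + b}.
Proof. by move=> a b; rewrite /qvec_scale scalerDl; apply: scalerDl. Qed.

HB.instance Definition _ (Fq : fieldType) (F : fieldExtType Fq) (k : nat) :=
  GRing.Zmodule_isLmodule.Build Fq (qvec F k)
    (@qvec_scaleA Fq F k) (@qvec_scale1 Fq F k)
    (@qvec_scaleDr Fq F k) (@qvec_scaleDl Fq F k).

Lemma qvec_scaleE (Fq : fieldType) (F : fieldExtType Fq) (k : nat)
  (a : Fq) (v : qvec F k) j :
  (a *: v : qvec F k) ord0 j = a *: ((v : 'rV[F]_k) ord0 j).
Proof. by rewrite [LHS]mxE mulr_algl. Qed.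

Definition qvec_ffun (Fq : fieldType) (F : fieldExtType Fq) (k : nat)
  (v : qvec F k) : {ffun 'I_k -> F} := [ffun j => (v : 'rV[F]_k) ord0 j].

Fact qvec_vect_iso (Fq : fieldType) (F : fieldExtType Fq) (k : nat) :
  Vector.axiom (dim {ffun 'I_k -> F}) (qvec F k).
Proof.
exists (fun v => v2r (qvec_ffun v)).
  move=> a u v; rewrite -linearP; congr (v2r _).
  by apply/ffunP=> j; rewrite !ffunE -qvec_scaleE [LHS]mxE.
exists (fun r => (\row_j (r2v r : {ffun 'I_k -> F}) j) : qvec F k).
  by move=> v; apply/rowP=> j; rewrite mxE v2rK ffunE.
by move=> r; rewrite -[RHS]r2vK; congr (v2r _); apply/ffunP=> j;
  rewrite ffunE mxE.
Qed.

HB.instance Definition _ (Fq : fieldType) (F : fieldExtType Fq) (k : nat) :=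
  Lmodule_hasFinDim.Build Fq (qvec F k) (@qvec_vect_iso Fq F k).

Definition qvec_coker (Fq : fieldType) (F : fieldExtType Fq) (p k : nat)
  (H : 'M[F]_(p, k)) (v : qvec F k) : qvec F k := v *m cokermx H.

Fact qvec_coker_is_linear (Fq : fieldType) (F : fieldExtType Fq) (p k : nat)
  (H : 'M[F]_(p, k)) : linear (qvec_coker H).
Proof.
move=> a u w; rewrite /qvec_coker mulmxDl; congr (_ + _).
by rewrite /GRing.scale /= /qvec_scale -scalemxAl.
Qed.

HB.instance Definition _ (Fq : fieldType) (F : fieldExtType Fq) (p k : nat)
  (H : 'M[F]_(p, k)) :=
  GRing.isLinear.Build Fq (qvec F k) (qvec F k) _ (qvec_coker H)
    (qvec_coker_is_linear H).

(* The F-subspace spanned by the rows of H, as an F_q-subspace of F^k. *)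
Definition resv (Fq : fieldType) (F : fieldExtType Fq) (p k : nat)
  (H : 'M[F]_(p, k)) : {vspace qvec F k} := lker (linfun (qvec_coker H)).

Lemma mem_resv (Fq : fieldType) (F : fieldExtType Fq) (p k : nat)
  (H : 'M[F]_(p, k)) (v : qvec F k) :
  (v \in resv H) = ((v : 'rV[F]_k) <= H)%MS.
Proof. by rewrite memv_ker submxE lfunE. Qed.

Definition columns (Fq : fieldType) (F : fieldExtType Fq) (k n : nat)
  (G : 'M[F]_(k, n)) : n.-tuple (qvec F k) :=
  [tuple ((col j G)^T : qvec F k) | j < n].

Definition colspan (Fq : fieldType) (F : fieldExtType Fq) (k n : nat)
  (G : 'M[F]_(k, n)) : {vspace qvec F k} := <<columns G>>%VS.

Definition is_minimum (P : nat -> Prop) (d : nat) : Prop :=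
  P d /\ forall e, P e -> (d <= e)%N.

(* The F-span of U is the row space of the matrix whose rows are an F_q-basis
   of U. *)
Definition Fspan (Fq : fieldType) (F : fieldExtType Fq) (k : nat)
  (U : {vspace qvec F k}) : 'M[F]_(\dim U, k) :=
  \matrix_i (tnth (vbasis U) i : 'rV[F]_k).

Definition is_qsystem (Fq : fieldType) (F : fieldExtType Fq) (n k : nat)
  (U : {vspace qvec F k}) : Prop :=
  \dim U = n /\ row_full (Fspan U).

Definition scattered (Fq : fieldType) (F : fieldExtType Fq) (h k : nat)
  (U : {vspace qvec F k}) : Prop :=
  forall H : 'M[F]_k, \rank H = h -> (\dim (U :&: resv H) <= h)%N.

Definition extremal_scattered (Fq : fieldType) (F : fieldExtType Fq)
  (h k : nat) (U : {vspace qvec F k}) : Prop :=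
  scattered h U /\ \dim U = ((k * \dim {:F}) %/ (h + 1))%N.

(* Vectors of F^k are rows here, so M acts through its transpose. *)
Definition system_equiv (Fq : fieldType) (F : fieldExtType Fq) (k : nat)
  (U U' : {vspace qvec F k}) : Prop :=
  exists (M : 'M[F]_k) (sigma : {rmorphism F -> F}),
    [/\ M \in unitmx, bijective sigma
      & forall v : qvec F k, v \in U' <->
          exists2 u : qvec F k, u \in U
            & v = map_mx sigma (u : 'rV[F]_k) *m M^T].

Definition dual_code (F : fieldType) (p n : nat) (C : 'M[F]_(p, n)) :
  'M[F]_n := kermx C^T.

Lemma dual_codeP (F : fieldType) (p n : nat) (C : 'M[F]_(p, n))
  (y : 'rV[F]_n) :
  reflect (forall x : 'rV[F]_n, (x <= C)%MS -> x *m y^T = 0)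
          (y <= dual_code C)%MS.
Proof.
apply: (iffP sub_kermxP) => [yC x /submxP[u ->] | yC].
  by rewrite -mulmxA -[C *m _]trmxK trmx_mul trmxK yC trmx0 mulmx0.
apply: trmx_inj; rewrite trmx_mul trmxK trmx0; apply/row_matrixP=> i.
by rewrite row_mul yC ?row_sub // row0.
Qed.

Definition is_generator (F : fieldType) (r p n : nat) (G : 'M[F]_(r, n))
  (C : 'M[F]_(p, n)) : bool := row_free G && (G == C)%MS.

Definition rank_weight (Fq : fieldType) (F : fieldExtType Fq) (n : nat)
  (x : 'rV[F]_n) : nat := \dim <<[seq x ord0 j | j : 'I_n]>>%VS.

Definition is_min_distance (Fq : fieldType) (F : fieldExtType Fq) (p n : nat)
  (C : 'M[F]_(p, n)) (d : nat) : Prop :=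
  is_minimum (fun w => exists x : 'rV[F]_n,
    [/\ (x <= C)%MS, x != 0 & rank_weight x = w]) d.

Definition is_code (Fq : fieldType) (F : fieldExtType Fq) (p n : nat)
  (C : 'M[F]_(p, n)) (r d : nat) : Prop :=
  \rank C = r /\ is_min_distance C d.

Definition nondegenerate (Fq : fieldType) (F : fieldExtType Fq) (p n : nat)
  (C : 'M[F]_(p, n)) : bool := free (columns (row_base C)).

Definition associated (Fq : fieldType) (F : fieldExtType Fq) (p n k : nat)
  (C : 'M[F]_(p, n)) (U : {vspace qvec F k}) : Prop :=
  nondegenerate C /\
  exists2 G : 'M[F]_(k, n), is_generator G C & U = colspan G.

Definition expand (Fq : fieldType) (F : fieldExtType Fq) (n : nat)
  (x : 'rV[F]_n) : 'M[Fq]_(\dim {:F}, n) :=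
  \matrix_(i, j) coord (vbasis {:F}) i (x ord0 j).

Definition Rsupp (Fq : fieldType) (F : fieldExtType Fq) (p n : nat)
  (V : 'M[F]_(p, n)) : 'M[Fq]_n :=
  (\sum_(i < \rank V) <<expand (row i (row_base V))>>)%MS.

(* d_2(C) = w *)
Definition is_d2 (Fq : fieldType) (F : fieldExtType Fq) (p n : nat)
  (C : 'M[F]_(p, n)) (w : nat) : Prop :=
  is_minimum (fun e => exists V : 'M[F]_n,
    [/\ (V <= C)%MS, \rank V = 2%N & \rank (Rsupp V) = e]) w.

Definition order_one_summand (Fq : fieldType) (F : fieldExtType Fq) (n : nat)
  (C : 'M[F]_n) : Prop :=
  nondegenerate C /\ is_code C 2 (\dim {:F} - 1).

(* The direct sum of the row spaces of the square matrices D_i on consecutive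
   coordinate blocks is the row space of the block diagonal matrix. *)
Definition order_one_direct_sum (Fq : fieldType) (F : fieldExtType Fq)
  (l : nat) (s : 'I_l -> nat)
  (D : 'M[F]_(\sum_(i < l) (\dim {:F} + s i))) : Prop :=
  exists2 Ds : forall i : 'I_l, 'M[F]_(\dim {:F} + s i),
    forall i, order_one_summand (Ds i) & (D :=: \mxdiag_(i < l) Ds i)%MS.

Definition Ccoef (q a r : nat) : nat := ((q ^ (a * r) - 1) %/ (q ^ a - 1))%N.

Definition is_power (F : fieldType) (t : nat) (c : F) : Prop :=
  exists2 v : F, v != 0 & c = v ^+ t.

(* alpha A i is alpha_i, with A = (alpha_1, ..., alpha_l) and the subscript i
   read modulo l. *)
Definition alpha (F : fieldType) (l : nat) (A : l.-tuple F) (i : nat) : F :=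
  A`_((i + l - 1) %% l).

Definition kappa (Fq : finFieldType) (F : fieldExtType Fq) (l : nat)
  (A : l.-tuple F) (I J : nat) : F :=
  let q := #|Fq| in let K := (J - I)%N in
  alpha A 1 ^+ (q ^ ((l - 2) * K))
    * \prod_(3 <= u < l.+1) alpha A u ^+ (q ^ ((u - 3) * K))
  / alpha A 2 ^+ Ccoef q K (l - 1).

(* The subscript i + l - j is i - j modulo l, without truncation as j < l. *)
Definition Pi (Fq : finFieldType) (F : fieldExtType Fq) (l : nat)
  (A : l.-tuple F) (I J i : nat) : F :=
  let q := #|Fq| in let K := (J - I)%N in
  \prod_(0 <= j < l) alpha A (i + l - j) ^+ (q ^ ((l - 1 - j) * K)).

(* With i : 'I_l counted from 0, entry i is f_{i+1}; ordS is the cyclic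
   successor, so the last entry involves x_1 and alpha_1. *)
Definition fA (Fq : finFieldType) (F : fieldExtType Fq) (l : nat)
  (A : l.-tuple F) (I J : nat) (x : 'rV[F]_l) : 'rV[F]_l :=
  let q := #|Fq| in
  \row_(i < l) (x ord0 i ^+ (q ^ I)
                + tnth A (ordS i) * x ord0 (ordS i) ^+ (q ^ J)).

Definition WA_map (Fq : finFieldType) (F : fieldExtType Fq) (l : nat)
  (A : l.-tuple F) (I J : nat) (x : qvec F l) : qvec F (l + l) :=
  row_mx x (fA A I J x).

Lemma frob_linear (Fq : finFieldType) (F : fieldExtType Fq) (k : nat)
  (a : Fq) (x y : F) :
  (a *: x + y) ^+ (#|Fq| ^ k) = a *: x ^+ (#|Fq| ^ k) + y ^+ (#|Fq| ^ k).
Proof.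
elim: k => [|k IHk]; first by rewrite expn0 !expr1.
rewrite expnSr !exprM IHk.
have [p pr_p charp] := finPcharP Fq.
have charF : p \in [pchar F] by rewrite (pchar_lalg F).
have pn : [pchar F].-nat #|Fq|.
  rewrite (eq_pnat _ (pcharf_eq charF)) -cardsT.
  by case/and3P: (fin_ring_pchar_abelem charp).
by rewrite exprDn_pchar // exprZn expf_card.
Qed.

Lemma WA_map_linear (Fq : finFieldType) (F : fieldExtType Fq) (l : nat)
  (A : l.-tuple F) (I J : nat) : linear (WA_map A I J).
Proof.
move=> a x y; apply/rowP=> j.
rewrite [RHS]mxE qvec_scaleE -(splitK j); case: (split j) => i /=.
  rewrite !row_mxEl [LHS]mxE; congr (_ + _); exact: qvec_scaleE.
have fE z : fA A I J z ord0 i = z ord0 i ^+ (#|Fq| ^ I)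
    + tnth A (ordS i) * z ord0 (ordS i) ^+ (#|Fq| ^ J) by rewrite mxE.
have E z : (a *: x + y : qvec F l) ord0 z = a *: (x ord0 z) + y ord0 z.
  by rewrite [LHS]mxE qvec_scaleE.
rewrite !row_mxEr !fE !E !frob_linear mulrDr -scalerAr scalerDr -!addrA.
by congr (_ + _); rewrite addrCA.
Qed.

HB.instance Definition _ (Fq : finFieldType) (F : fieldExtType Fq) (l : nat)
  (A : l.-tuple F) (I J : nat) :=
  GRing.isLinear.Build Fq (qvec F l) (qvec F (l + l)) _ (WA_map A I J)
    (WA_map_linear A I J).

Definition WA (Fq : finFieldType) (F : fieldExtType Fq) (l : nat)
  (A : l.-tuple F) (I J : nat) : {vspace qvec F (l + l)} :=
  limg (linfun (WA_map A I J)).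

Lemma mem_WA (Fq : finFieldType) (F : fieldExtType Fq) (l : nat)
  (A : l.-tuple F) (I J : nat) (v : qvec F (l + l)) :
  v \in WA A I J <-> exists x : 'rV[F]_l, v = row_mx x (fA A I J x).
Proof.
split=> [/memv_imgP[x _ ->] | [x ->]]; first by exists x; rewrite lfunE.
by apply/memv_imgP; exists (x : qvec F l); rewrite ?memvf // lfunE.
Qed.

(* Z_B: the 0-based row l is the position of f_1. *)
Definition ZB (F : fieldType) (l s : nat) (b : s.-tuple F) :
  'M[F]_(l + l, s) :=
  \matrix_(i, j) (if i == l :> nat then tnth b j else 0).

Definition HAB (F : fieldType) (l n s : nat) (H0 : 'M[F]_(l + l, n))
  (b : s.-tuple F) : 'M[F]_(l + l, n + s) := row_mx H0 (ZB l b).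

(* Main.v *)
Require Import Defs.
From HB Require Import structures.
From mathcomp Require Import all_boot all_order all_fingroup all_algebra.
From mathcomp Require Import all_field.
From mathcomp Require Import zify ring.
Import GRing.Theory.
Local Open Scope ring_scope.

(** Write [frob k] for the [q ^ k]-power map of [F].  A word of the code [D]
    is [w *m H] with [w = (u, v)], and the span of its coordinates contains
    the values on [W_A] of the linear form defined by [w].  On the vectors of
    [W_A] that come from the [k]-th coordinate axis this form is
      [cform w k z = u_k z + v_k z ^ (q ^ I) + v_(k-1) alpha_k z ^ (q ^ J)],
    so a weight of [D] is bounded below once the dimension of every space that
    contains all values of these [l] additive polynomials is.

    The condition on [kappa] enters through [no_twisted_cycle]: the relations
    [v_k ^ (q ^ K) = c alpha_k v_(k-1)] have no nonzero solution for any [c].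
    Substituting them into each other once around the cycle would write
    [kappa] as a power of exponent [(q ^ (l K) - 1) / (q ^ K - 1)].

    Nonzero words have weight at least [m - 1] ([cyclic_forms_span]).  If the
    values of the [cform w k] lay in a space of codimension two, there would
    be independent [y1, y2] that are trace-orthogonal to all of them.  Put
    [D a = y1 ^ (q ^ a) y2 - y1 y2 ^ (q ^ a)].  Passing to the adjoint polynomials
    and eliminating [u_k] gives
      [(v_k D I) ^ (q ^ K) = - alpha_k v_(k-1) D J],
    where [D I] and [D J] are not both zero because [I] and [J] are coprime.  So
    either [v = 0] at once or [v] times [D I] is a twisted cycle and [v = 0]
    again; then [u = 0].

    Two-dimensional subcodes have support of dimension at least [2 m - 2 J].
    Take a basis [(u, v), (u', v')].  If [v] and [v'] are dependent, arrange
    [v' = 0] ([pair_forms_degenerate]): differences of values give pairs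
    [(p(z), 0)] with [p] an additive polynomial of degree at most [q ^ J],
    and [p] is nonzero for some choice, since otherwise [v] would be a twisted
    cycle or, with [v = 0], the two basis vectors would be dependent.  If [v] and [v'] are independent ([pair_forms_regular]), two
    coordinate axes give a map from [F * F] to [F * F] whose kernel satisfies a
    system of order [J] in two unknowns, hence has dimension at most [2 J] by a
    Moore determinant argument ([frob_stable_rank]).

    The rest is duality.  A minimum distance of at least [h + 2] for [D] makes
    the columns of [G] independent and their span [h]-scattered
    ([dist_ge_scattered]); here [h = m - 3].  An equivalence with a system
    attached to the dual of a direct sum would carry the two-dimensional
    summand [D_(s_i)] onto a subcode of [D] with support of dimension at most
    [m + s_i] ([equiv_d2_le]); for the smallest [s_i] this is at most
    [m + s / l], which is below [2 m - 2 J]. *)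

Set Implicit Arguments.
Unset Strict Implicit.
Unset Printing Implicit Defensive.

(** * The Frobenius map and the trace *)

Section Frobenius.
Context (Fq : finFieldType) (F : fieldExtType Fq).
Local Notation q := #|Fq|.
Local Notation m := (\dim {:F}).

Definition frob (k : nat) (x : F) : F := x ^+ (q ^ k).

Fact frob_is_linear k : linear (frob k).
Proof. by move=> a x y; apply: frob_linear. Qed.
HB.instance Definition _ k :=
  GRing.isLinear.Build Fq F F _ (frob k) (frob_is_linear k).

Fact frob_is_monoid_morphism k : monoid_morphism (frob k).
Proof. by split=> [|x y]; rewrite /frob ?expr1n ?exprMn. Qed.
HB.instance Definition _ k :=
  GRing.isMonoidMorphism.Build F F (frob k) (frob_is_monoid_morphism k).

Lemma q_gt1 : (1 < q)%N.
Proof. exact: finNzRing_gt1. Qed.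

Lemma frob0 x : frob 0 x = x.
Proof. by rewrite /frob expn0 expr1. Qed.

Lemma frobD a b x : frob (a + b) x = frob a (frob b x).
Proof. by rewrite /frob -exprM -expnD addnC. Qed.

Lemma frob_order x : frob m x = x.
Proof.
have := expf_card (x : finvect_type F).
have -> : #|finvect_type F| = (q ^ m)%N; last by [].
rewrite -(card_vspace (fullv : {vspace finvect_type F})).
by apply: eq_card => y; rewrite memvf.
Qed.

Lemma frobK k : (k <= m)%N -> cancel (frob (m - k)) (frob k).
Proof. by move=> km x; rewrite -frobD subnKC // frob_order. Qed.

Lemma frob1_fixed (x : F) : frob 1 x = x -> exists c : Fq, x = c%:A.
Proof.
rewrite /frob expn1 => xq.
have E := finField_genPoly Fq.
have: root (map_poly (in_alg F) ('X^q - 'X)) x.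
  by rewrite rmorphB /= map_polyXn map_polyX rootE !hornerE xq subrr.
rewrite E rmorph_prod -big_enum /= rootE horner_prod prodf_seq_eq0.
case/hasP=> c _; rewrite rmorphB /= map_polyX map_polyC /= !hornerE subr_eq0.
by move/eqP=> ->; exists c.
Qed.

(** The exponents of the Frobenius powers that fix [x] are closed under
    differences, so Bezout gives exponent one. *)
Lemma frob_fixed_coprime a b (x : F) :
  (0 < a)%N -> coprime a b -> frob a x = x -> frob b x = x -> frob 1 x = x.
Proof.
move=> a0 cop xa xb.
have it n k : frob n x = x -> frob (k * n) x = x.
  by move=> xn; elim: k => [|k IH]; rewrite ?frob0 // mulSn frobD IH.
case: (egcdnP b a0) => u v E _; rewrite (eqP cop) in E.
by rewrite -{2}(it _ u xa) E addnC frobD it.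
Qed.

(** Counting roots: a space of dimension [d] has [q ^ d] elements. *)
Lemma dim_roots (p : {poly F}) (S : {vspace F}) d :
  p != 0 -> (size p <= (q ^ d).+1)%N -> (forall x, x \in S -> root p x) ->
  (\dim S <= d)%N.
Proof.
move=> p0 sp rS.
pose s : seq (finvect_type F) := enum (S : {vspace finvect_type F}).
have: (size s < size p)%N.
  apply: (@max_poly_roots F p s p0); last exact: enum_uniq.
  apply/allP=> x xs; apply: rS.
  by have := mem_enum (mem (S : {vspace finvect_type F})) x; rewrite xs.
rewrite -cardE card_vspace => lt; rewrite -(leq_exp2l _ _ q_gt1).
by rewrite -ltnS (leq_trans lt).
Qed.

(** An additive polynomial of degree at most [q ^ J] has at most [q ^ J] roots.
    The bound [0 < I < J] keeps its three monomials distinct. *)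
Lemma dim_frob3_ker a b c I J (S : {vspace F}) :
  (0 < I)%N -> (I < J)%N -> [|| a != 0, b != 0 | c != 0] ->
  (forall x, x \in S -> a * x + b * frob I x + c * frob J x = 0) ->
  (\dim S <= J)%N.
Proof.
move=> I0 IJ nz zS.
pose p : {poly F} := a *: 'X + b *: 'X^(q ^ I) + c *: 'X^(q ^ J).
have [q1 q2] : (1 < q ^ I /\ q ^ I < q ^ J)%N.
  by rewrite ltn_exp2l ?q_gt1 // -{1}(expn0 q) ltn_exp2l ?q_gt1.
have E k : p`_k = a *+ (k == 1%N) + b *+ (k == q ^ I)%N + c *+ (k == q ^ J)%N.
  by rewrite !coefE !mulr_natr.
apply: (@dim_roots p).
- apply: contraL nz => /eqP p0; move: (E 1%N) (E (q ^ I)%N) (E (q ^ J)%N).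
  rewrite p0 !coef0 !eqxx !(ltn_eqF q1) (ltn_eqF (ltn_trans q1 q2)).
  rewrite (ltn_eqF q2) !(gtn_eqF q1) !(gtn_eqF q2) (gtn_eqF (ltn_trans q1 q2)).
  by rewrite !mulr0n !mulr1n !addr0 !add0r => <- <- <-; rewrite !eqxx.
- apply/leq_sizeP=> k kq; have q3 := ltn_trans q1 q2.
  rewrite E (gtn_eqF kq) (gtn_eqF (ltn_trans q2 kq)) (gtn_eqF (ltn_trans q3 kq)).
  by rewrite !mulr0n !addr0.
- by move=> x /zS; rewrite rootE !hornerE => /eqP.
Qed.

(** The trace to the base field, kept with values in [F]; its values are fixed
    by [frob 1], so they do lie in the base field. *)
Definition qtrace (x : F) : F := \sum_(i < m) frob i x.

Fact qtrace_is_linear : linear qtrace.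
Proof.
move=> a x y; rewrite /qtrace scaler_sumr -big_split /=.
by apply: eq_bigr => i _; rewrite linearP.
Qed.
HB.instance Definition _ :=
  GRing.isLinear.Build Fq F F _ qtrace qtrace_is_linear.

Lemma qtrace_frob1 x : qtrace (frob 1 x) = qtrace x.
Proof.
rewrite /qtrace; case: m (frob_order x) => [|n] E; first by rewrite !big_ord0.
rewrite big_ord_recr big_ord_recl /= -frobD addn1 E frob0 addrC.
by congr (_ + _); apply: eq_bigr => i _; rewrite -frobD addn1.
Qed.

Lemma qtrace_frob k x : qtrace (frob k x) = qtrace x.
Proof.
by elim: k => [|k IH]; rewrite ?frob0 // -addn1 addnC frobD qtrace_frob1.
Qed.

Lemma frob_qtrace x : frob 1 (qtrace x) = qtrace x.
Proof.
rewrite -[RHS]qtrace_frob1 /qtrace rmorph_sum /=.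
by apply: eq_bigr => i _; rewrite -!frobD addnC.
Qed.

(** The trace is a polynomial of degree [q ^ (m - 1)], too small to vanish on
    all [q ^ m] elements. *)
Lemma qtrace_neq0 : exists x, qtrace x != 0.
Proof.
have m0 : (0 < m)%N := adim_gt0 {:F}.
pose p : {poly F} := \sum_(i < m) 'X^(q ^ i).
have p0 : p != 0.
  apply/negP=> /eqP p0; have := congr1 (fun r : {poly F} => r`_1) p0.
  rewrite coef0 coef_sum (bigD1 (Ordinal m0)) //= big1 ?addr0.
    by rewrite coefXn expn0 eqxx => /eqP; rewrite oner_eq0.
  move=> i; rewrite -val_eqE /= -lt0n => i0; rewrite coefXn.
  by rewrite -{1}(expn0 q) eqn_exp2l ?q_gt1 // ltn_eqF.
have sp : (size p <= (q ^ m.-1).+1)%N.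
  apply: (leq_trans (size_sum _ _ _)); apply/bigmax_leqP=> i _.
  by rewrite size_polyXn ltnS leq_exp2l ?q_gt1 //; move: (ltn_ord i); lia.
case: (pickP (fun x : finvect_type F => ~~ root p x)) => [x|all0].
  rewrite rootE horner_sum => nz; exists (x : F).
  by rewrite /qtrace; under eq_bigr => i _ do rewrite -[frob i x]hornerXn.
have := @dim_roots p {:F} _ p0 sp (fun x _ => negbFE (all0 x)).
by rewrite -ltnS prednK // ltnn.
Qed.

Lemma qtrace_nondeg (y : F) : (forall x, qtrace (y * x) = 0) -> y = 0.
Proof.
move=> T0; apply/eqP/negPn/negP=> y0; have [x] := qtrace_neq0.
by rewrite -[x](mulVKf y0) T0 eqxx.
Qed.

End Frobenius.

(** * Twisted cycles and the constant kappa *)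

Lemma Ccoef_sum q a r : (1 < q)%N -> (0 < a)%N ->
  Ccoef q a r = (\sum_(j < r) q ^ (j * a))%N.
Proof.
move=> q1 a0; have qa : (1 < q ^ a)%N by rewrite -{1}(expn0 q) ltn_exp2l.
rewrite /Ccoef expnM !subn1 predn_exp mulKn; last by lia.
by apply: eq_bigr => j _; rewrite -expnM mulnC.
Qed.

Lemma CcoefM q a r : (1 < q)%N -> (0 < a)%N ->
  ((q ^ a).-1 * Ccoef q a r)%N = (q ^ (r * a)).-1.
Proof.
move=> q1 a0; rewrite Ccoef_sum // [(r * a)%N]mulnC expnM [in RHS]predn_exp.
by congr (_ * _)%N; apply: eq_bigr => j _; rewrite -expnM mulnC.
Qed.

Section Cycle.
Context (Fq : finFieldType) (F : fieldExtType Fq).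
Local Notation q := #|Fq|.
Context (l : nat) (l2 : (1 < l)%N) (A : l.-tuple F).

Let l0 : (0 < l)%N := ltnW l2.

(** The 0-based index that carries the 1-based cyclic subscript [n]. *)
Definition cyc (n : nat) : 'I_l := Ordinal (ltn_pmod (n + l - 1) l0).

Lemma alpha_cyc n : alpha A n = tnth A (cyc n).
Proof. by rewrite (tnth_nth 0). Qed.

Lemma cycS n : cyc n.+1 = ordS (cyc n).
Proof.
by apply: val_inj; rewrite /= -[in RHS]addn1 modnDml; congr (_ %% _)%N; lia.
Qed.

Lemma cycDl n : cyc (n + l) = cyc n.
Proof.
by apply: val_inj; rewrite /= -[RHS]modnDr; congr (_ %% _)%N; lia.
Qed.

Lemma cycE (i : 'I_l) k : cyc (k * l + i.+1) = i.
Proof.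
apply: val_inj; rewrite /= (_ : _ + l - 1 = k.+1 * l + i)%N; last by nia.
by rewrite modnMDl modn_small.
Qed.

Context (hA : forall i, tnth A i != 0) (I J : nat) (hIJ : (I < J)%N).
Local Notation K := (J - I)%N.

Lemma alpha_neq0 n : alpha A n != 0.
Proof. by rewrite alpha_cyc. Qed.

(** [kappa] is, up to a [Ccoef]-th power of [alpha_2], the product picked up on
    one turn around the cycle; both factors of index 2 are absorbed by the
    identity [Ccoef q K l = Ccoef q K (l - 1) + q ^ ((l - 1) K)]. *)
Lemma kappaE :
  kappa A I J * alpha A 2 ^+ Ccoef q K l
  = \prod_(j < l) alpha A (j + 3) ^+ (q ^ (j * K)).
Proof.
have K0 : (0 < K)%N by rewrite subn_gt0.
have q1 := q_gt1 Fq.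
rewrite /kappa; case: l l2 A alpha_neq0 => [//|[//|n]] n2 B B0.
have aE k : alpha B (n.+2 + k) = alpha B k.
  by rewrite /alpha -addnA -addnBA ?modnDl //; lia.
rewrite !big_ord_recr /= (_ : n + 3 = n.+2 + 1)%N; last by lia.
rewrite (_ : n.+1 + 3 = n.+2 + 2)%N; last by lia.
rewrite !aE (_ : n.+2 - 2 = n)%N; last by lia.
rewrite (_ : n.+2 - 1 = n.+1)%N; last by lia.
have -> : Ccoef q K n.+2 = (Ccoef q K n.+1 + q ^ (n.+1 * K))%N.
  by rewrite !Ccoef_sum // [LHS]big_ord_recr.
rewrite exprD mulrA divfK ?expf_neq0 //; congr (_ * _).
rewrite mulrC; congr (_ * _).
rewrite (_ : n.+3 = n + 3)%N; last by lia.
have -> P : \prod_(3 <= u < n + 3) P u = \prod_(0 + 3 <= u < n + 3) P u :> F.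
  by [].
rewrite big_addn addnK big_mkord.
by apply: eq_bigr => i _; rewrite addnK.
Qed.

(** Iterating once around the cycle shows that [w ^ (q ^ (l K) - 1)] is a power
    of [c] with exponent [Ccoef q K l] times the product in [kappaE].  As
    [q ^ (l K) - 1] is itself [q ^ K - 1] times [Ccoef q K l], all factors other
    than [kappa] are powers with that exponent. *)
Lemma twisted_cycle_kappa (c : F) (w : 'I_l -> F) :
  (forall i, frob K (w (ordS i)) = c * tnth A (ordS i) * w i) ->
  (exists i, w i != 0) -> is_power (Ccoef q K l) (kappa A I J).
Proof.
move=> ww [i0 wi0].
have K0 : (0 < K)%N by rewrite subn_gt0.
have q1 := q_gt1 Fq.
pose W n := w (cyc n).
have step n : frob K (W n.+1) = c * alpha A n.+1 * W n.
  by rewrite alpha_cyc /W cycS ww.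
have walk n k : frob (k * K) (W (n + k)%N)
    = c ^+ (\sum_(j < k) q ^ (j * K)) *
      \prod_(j < k) alpha A (j + n.+1) ^+ (q ^ (j * K)) * W n.
  elim: k => [|k IH]; first by rewrite !big_ord0 addn0 mul0n frob0 !mul1r.
  rewrite mulSn [(K + _)%N]addnC frobD addnS step !rmorphM /= IH.
  rewrite !big_ord_recr /= exprD (_ : (n + k).+1 = k + n.+1)%N; last by lia.
  by rewrite /frob; ring.
have W2 : W 2 != 0.
  apply: contraNneq wi0 => W0.
  have := walk 2 (1 * l + i0.+1 - 2 + l)%N; rewrite W0 mulr0.
  rewrite (_ : 2 + _ = 2 * l + i0.+1)%N; last by lia.
  by rewrite /W cycE => /eqP; rewrite fmorph_eq0.
have c0 : c != 0.
  apply: contraNneq wi0 => c0; have := ww (ord_pred i0).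
  by rewrite ord_predK c0 !mul0r => /eqP; rewrite fmorph_eq0.
have := walk 2 l; rewrite /W [cyc (2 + l)]cycDl -/(W 2) -kappaE -Ccoef_sum //.
set C := Ccoef q K l; set z := W 2; set a := alpha A 2 => E.
have a0 : a != 0 := alpha_neq0 2.
exists (z ^+ (q ^ K).-1 / (c * a)).
  by rewrite mulf_neq0 ?invr_eq0 ?mulf_neq0 ?expf_neq0.
rewrite expr_div_n -exprM CcoefM // exprMn.
apply: (canRL (mulfK _)); first by rewrite mulf_neq0 ?expf_neq0.
apply: (mulIf W2); rewrite -/z -exprSr prednK ?expn_gt0 ?(ltnW q1) //.
by rewrite -[RHS]/(frob (l * K) z) E; ring.
Qed.

End Cycle.

(** * Trace duality and the minimum distance *)
Section TraceDual.
Context (Fq : finFieldType) (F : fieldExtType Fq).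
Local Notation m := (\dim {:F}).

Definition qcoord (x : F) : Fq := coord [tuple (1 : F)] ord0 x.

Lemma qcoordE (x : F) : frob 1 x = x -> x = (qcoord x)%:A.
Proof.
case/frob1_fixed=> c xc.
have /coord_span : x \in <<[tuple (1%R : F)]>>%VS.
  by rewrite xc span_seq1 rpredZ // memv_line.
by rewrite big_ord1.
Qed.

Lemma qtraceE (x : F) : qtrace x = (qcoord (qtrace x))%:A.
Proof. exact/qcoordE/frob_qtrace. Qed.

Section Functionals.
Context (S : {vspace F}).

Definition trace_pairing (y : F) : 'rV[Fq]_(\dim S) :=
  \row_i qcoord (qtrace (y * (vbasis S)`_i)).

Fact trace_pairing_is_linear : linear trace_pairing.
Proof.
move=> a x y; apply/rowP=> i; rewrite !mxE /qcoord.
by rewrite mulrDl -scalerAl !linearP.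
Qed.
HB.instance Definition _ :=
  GRing.isLinear.Build Fq F _ _ trace_pairing trace_pairing_is_linear.

(** Pairing with a basis of [S] through the trace imposes only [dim S] linear
    conditions over the base field, because the trace takes values there. *)
Lemma trace_annihilator :
  exists2 Y : {vspace F}, (m <= \dim S + \dim Y)%N
    & forall y s, y \in Y -> s \in S -> qtrace (y * s) = 0.
Proof.
exists (lker (linfun trace_pairing)).
  rewrite -(limg_ker_dim (linfun trace_pairing) {:F}) capfv addnC leq_add2r.
  by rewrite (leq_trans (dimvS (subvf _))) // dimvf dim_matrix mul1r.
move=> y s; rewrite memv_ker lfunE => /eqP /rowP yS sS.
rewrite (coord_vbasis sS) mulr_sumr linear_sum big1 // => i _.
rewrite -scalerAr linearZ /= qtraceE.
by have := yS i; rewrite !mxE => ->; rewrite scale0r scaler0.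
Qed.

End Functionals.
End TraceDual.

Section Forms.
Context (Fq : finFieldType) (F : fieldExtType Fq).
Local Notation m := (\dim {:F}).
Context (l : nat) (l2 : (1 < l)%N) (A : l.-tuple F).
Context (hA : forall i, tnth A i != 0) (I J : nat) (I0 : (0 < I)%N).
Context (hIJ : (I < J)%N) (hJ : (J < m)%N) (hcop : coprime I J).
Local Notation K := (J - I)%N.
Context (hkappa : ~ is_power (Ccoef #|Fq| K l) (kappa A I J)).

Definition qpoly3 (a b c z : F) : F := a * z + b * frob I z + c * frob J z.

Fact qpoly3_is_linear a b c : linear (qpoly3 a b c).
Proof.
move=> t x y; rewrite /qpoly3 !linearP /= !mulrDr -!scalerAr !scalerDr.
by rewrite -!addrA; congr (_ + _); ring.
Qed.
HB.instance Definition _ a b c :=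
  GRing.isLinear.Build Fq F F _ (qpoly3 a b c) (qpoly3_is_linear a b c).

Lemma dim_limg_qpoly3 a b c : [|| a != 0, b != 0 | c != 0] ->
  (m <= \dim (limg (linfun (qpoly3 a b c))) + J)%N.
Proof.
move=> nz; rewrite -(limg_ker_dim (linfun (qpoly3 a b c)) {:F}) capfv addnC.
rewrite leq_add2l (@dim_frob3_ker _ _ a b c I J) // => x.
by rewrite memv_ker lfunE => /eqP.
Qed.

(** For a functional [w = (u, v)] on [F ^ (2 l)], [lpart w] is [u] and [rpart w]
    is [v]. *)
Definition lpart (w : 'rV[F]_(l + l)) (k : 'I_l) : F := w 0 (lshift l k).
Definition rpart (w : 'rV[F]_(l + l)) (k : 'I_l) : F := w 0 (rshift l k).

(** The restriction of the functional [w] to the points of [W_A] that come from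
    the [k]-th coordinate axis, see [cformE]. *)
Definition cform (w : 'rV[F]_(l + l)) (k : 'I_l) : F -> F :=
  qpoly3 (lpart w k) (rpart w k) (rpart w (ord_pred k) * tnth A k).

Lemma cformE w k z :
  (w *m (WA_map A I J (z *: delta_mx 0 k))^T) 0 0 = cform w k z.
Proof.
have E i : (z *: delta_mx 0 k : 'rV[F]_l) 0 i = z *+ (i == k).
  by rewrite !mxE eqxx /= mulr_natr.
have fE n i : (z *+ (i == k)) ^+ (#|Fq| ^ n) = frob n z *+ (i == k).
  by rewrite -[LHS]/(frob n _) raddfMn.
rewrite mxE big_split_ord /= (bigD1 k) //= big1 => [|i ik]; last first.
  by rewrite mxE row_mxEl E (negPf ik) mulr0.
rewrite mxE row_mxEl E eqxx addr0.
under eq_bigr => i _ do rewrite mxE row_mxEr mxE !E !fE mulrDr.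
rewrite big_split /= (bigD1 k) //= [in X in _ + (_ + X + _)]big1 => [|i ik].
  rewrite eqxx addr0 [in X in _ + (_ + X)](bigD1 (ord_pred k)) //=.
  rewrite ord_predK eqxx big1 => [|i ik].
    by rewrite addr0 addrA mulrA.
  by rewrite -{1}(ord_predK k) (inj_eq (@ordS_inj l)) (negPf ik) !mulr0.
by rewrite (negPf ik) mulr0.
Qed.

Lemma forms_eq0 w :
  (forall k, lpart w k = 0) -> (forall k, rpart w k = 0) -> w = 0.
Proof.
move=> w0 w1; apply/rowP=> k; rewrite mxE -(splitK k).
by case: (split k) => i; [apply: w0 | apply: w1].
Qed.

Lemma no_twisted_cycle (c : F) (v : 'I_l -> F) :
  (forall k, frob K (v k) = c * tnth A k * v (ord_pred k)) ->
  forall k, v k = 0.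
Proof.
move=> cv k; apply/eqP/negPn/negP=> vk.
apply: hkappa; apply: (twisted_cycle_kappa l2 hA hIJ (c := c) (w := v)).
  by move=> i; rewrite cv ordSK.
by exists k.
Qed.

(** The adjoint of [cform w k] for the trace form, raised to the power [q ^ J]
    to clear the negative Frobenius exponents. *)
Lemma adjoint_cform (w : 'rV[F]_(l + l)) k (y : F) :
  (forall z, qtrace (y * cform w k z) = 0) ->
  frob J (lpart w k * y) + frob K (rpart w k * y)
    + rpart w (ord_pred k) * tnth A k * y = 0.
Proof.
move=> T0; apply: qtrace_nondeg => x.
rewrite -[x](frobK (ltnW hJ)); set z := frob _ x.
rewrite -[RHS](T0 z) /cform /qpoly3 !mulrDr !mulrDl !linearD /=.
have JE u : frob J u = frob K (frob I u) by rewrite -frobD subnK // ltnW.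
rewrite -(qtrace_frob J (y * (lpart w k * z))).
rewrite -(qtrace_frob K (y * (rpart w k * frob I z))) !rmorphM /= -!JE.
by congr (qtrace _ + qtrace _ + qtrace _); ring.
Qed.

(** If the values missed two dimensions, the trace-annihilator would contain
    independent [y1] and [y2]. Writing [D a] for the 2 x 2 Moore-type
    determinant of [y1, y2] with exponents [a] and [0], elimination of the
    [lpart] coefficients between the two adjoint equations turns [rpart w],
    scaled by [D I], into a twisted cycle with constant [- D J / D I]. *)
Lemma cyclic_forms_span (w : 'rV[F]_(l + l)) (S : {vspace F}) :
  w != 0 -> (forall k z, cform w k z \in S) -> (m <= (\dim S).+1)%N.
Proof.
move=> w0 wS; have [Y dY Y0] := trace_annihilator S.
rewrite leqNgt; apply: contra w0 => dS; apply/eqP.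
have Y1 : (1 < \dim Y)%N by lia.
have y10 : vpick Y != 0 by rewrite vpick0 -dimv_eq0; lia.
have [y2 Yy2 y2y1] : exists2 y2, y2 \in Y & y2 \notin <[vpick Y]>%VS.
  by apply/subvPn; apply: contraL Y1 => /dimvS; rewrite dim_vline y10 -leqNgt.
move: (vpick Y) (memv_pick Y) y10 y2y1 => y1 Yy1 y10 y2y1.
have adj y k : y \in Y -> frob J (lpart w k * y) + frob K (rpart w k * y)
    + rpart w (ord_pred k) * tnth A k * y = 0.
  by move=> Yy; apply: adjoint_cform => z; apply: Y0.
pose D a := frob a y1 * y2 - y1 * frob a y2.
have D0 a : D a = 0 -> frob a (y2 / y1) = y2 / y1.
  move/eqP; rewrite subr_eq0 => /eqP Da; rewrite fmorph_div /=.
  by apply/eqP; rewrite eqr_div ?fmorph_eq0 // [y2 * _]mulrC Da mulrC.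
(* multiply each adjoint equation by the other solution's [frob J] and subtract *)
have elim k : frob K (rpart w k * D I)
    = - (D J * (tnth A k * rpart w (ord_pred k))).
  have JE u : frob J u = frob K (frob I u) by rewrite -frobD subnK // ltnW.
  have := congr2 (fun a b => a * frob J y2 - b * frob J y1)
            (adj y1 k Yy1) (adj y2 k Yy2).
  rewrite !mul0r subr0 /D !rmorphM rmorphB !rmorphM /= -!JE => E.
  by apply/eqP; rewrite -subr_eq0 -oppr_eq0 -E; apply/eqP; ring.
(* [D a = 0] means that [y2 / y1] is fixed by [frob a] *)
have DIJ : D I = 0 -> D J != 0.
  move=> /D0 tI; apply/eqP=> /D0 tJ.
  have [c tc] := frob1_fixed (frob_fixed_coprime I0 hcop tI tJ).
  case/negP: y2y1; rewrite -[y2](divfK y10) tc mulr_algl.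
  by rewrite rpredZ ?memv_line.
have r0 : forall k, rpart w k = 0.
  have [DI|DI] := eqVneq (D I) 0 => k.
    have := elim (ordS k); rewrite DI mulr0 rmorph0 => /esym/eqP.
    rewrite ordSK oppr_eq0 !mulf_eq0 (negPf (DIJ DI)) (negPf (hA _)).
    by move/eqP.
  have cv j : frob K (rpart w j * D I)
      = - D J / D I * tnth A j * (rpart w (ord_pred j) * D I).
    by rewrite elim; field.
  have /eqP := no_twisted_cycle (v := fun j => rpart w j * D I) cv k.
  by rewrite mulf_eq0 (negPf DI) orbF => /eqP.
apply: forms_eq0 => // k.
have := adj y1 k Yy1; rewrite !r0 !mul0r rmorph0 !addr0 => /eqP.
by rewrite fmorph_eq0 mulf_eq0 (negPf y10) orbF => /eqP.
Qed.

End Forms.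

(** * Frobenius-stable row spaces and pairs of forms *)
Lemma leq_dim_limg (K : fieldType) (aT rT : vectType K) (f : 'Hom(aT, rT))
    (S : {vspace rT}) n :
  (limg f <= S)%VS -> (\dim (lker f) <= n)%N ->
  (\dim {:aT} <= \dim S + n)%N.
Proof.
move=> fS kn; rewrite -(limg_ker_dim f fullv) capfv addnC.
by rewrite leq_add ?dimvS.
Qed.

Section Moore.
Context (Fq : finFieldType) (F : fieldExtType Fq).
Local Notation m := (\dim {:F}).

(** The Moore determinant argument. If the row space of [T] is stable under
    Frobenius, so is the space of [F]-linear relations between the columns of
    [T]. A nonzero relation of minimal support, scaled to have an entry 1, is
    then fixed by Frobenius, since its difference with its Frobenius image has
    smaller support; so it is a relation over the base field. *)
Lemma frob_stable_rank N k (T : 'M[F]_(N, k)) :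
  (map_mx (@frob Fq F 1) T <= T)%MS ->
  (forall a : 'rV[Fq]_k, map_mx (in_alg F) a *m T^T = 0 -> a = 0) ->
  (k <= N)%N.
Proof.
move=> /submxP[R TR] indep; have m0 : (0 < m)%N := adim_gt0 {:F}.
suff ker0 (c : 'rV[F]_k) : c *m T^T = 0 -> c = 0.
  have /eqP <- : row_free T^T.
    rewrite -kermx_eq0; apply/eqP/row_matrixP=> i; rewrite row0.
    by apply: ker0; rewrite -row_mul mulmx_ker row0.
  exact: rank_leq_col.
have [n] := ubnP #|[pred i | c 0 i != 0]|; elim: n => // n IHn in c *.
rewrite ltnS => cn cT; apply/eqP/negPn/negP=> /rV0Pn[i ci].
pose c1 := (c 0 i)^-1 *: c.
have c1i : c1 0 i = 1 by rewrite mxE mulVf.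
have c1T : c1 *m T^T = 0 by rewrite -scalemxAl cT scaler0.
have frobm1 : map_mx (frob 1) (map_mx (frob (m - 1)) c1) = c1.
  by apply/rowP=> j; rewrite !mxE (frobK m0).
(* [frob (m - 1)] is the inverse Frobenius; the entry 1 cancels in [d] *)
pose d := map_mx (frob (m - 1)) c1 - c1.
have dT : d *m T^T = 0.
  apply: (map_mx_inj (f := @frob Fq F 1)).
  rewrite map_mxM map_mx0 map_mxB frobm1 mulmxBl -map_mxM c1T map_mx0 subr0.
  by rewrite -map_trmx TR trmx_mul mulmxA c1T mul0mx.
have d0 : d = 0.
  apply: IHn dT; apply: leq_trans cn; apply: proper_card; apply/properP; split.
    apply/subsetP=> j; rewrite !inE !mxE; apply: contraNneq => ->.
    by rewrite mulr0 rmorph0 subr0.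
  exists i; rewrite !inE ?ci // /d mxE [map_mx _ _ _ _]mxE.
  by rewrite [(- c1) _ _]mxE c1i rmorph1 subrr eqxx.
have c1fix j : frob 1 (c1 0 j) = c1 0 j.
  have /rowP/(_ j) := frobm1; have /eqP := d0; rewrite subr_eq0 => /eqP ->.
  by rewrite mxE.
have [a c1a] : exists a : 'rV[Fq]_k, c1 = map_mx (in_alg F) a.
  exists (\row_j qcoord (c1 0 j)); apply/rowP=> j.
  by rewrite [RHS]mxE [(\row__ _) _ _]mxE /= -(qcoordE (c1fix j)).
have := indep a; rewrite -c1a => /(_ c1T) a0.
by move/eqP: c1i; rewrite c1a a0 map_mx0 mxE eq_sym oner_eq0.
Qed.

(** A linear system of order [J] in two unknowns has a solution space of
    dimension at most [2 J]: the first [J] Frobenius iterates of both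
    coordinates of a basis of [U] span a stable row space. *)
Lemma dim_frob_system I J (U : {vspace (F * F)%type})
    (a1 a2 a3 a4 b1 b2 b3 b4 : F) :
  (I < J)%N ->
  (forall z, z \in U ->
     frob J z.1 = a1 * z.1 + a2 * frob I z.1 + a3 * z.2 + a4 * frob I z.2 /\
     frob J z.2 = b1 * z.1 + b2 * frob I z.1 + b3 * z.2 + b4 * frob I z.2) ->
  (\dim U <= J + J)%N.
Proof.
move=> IJ UJ; have J0 : (0 < J)%N by lia.
pose z (j : 'I_(\dim U)) := (vbasis U)`_j.
have zU j : z j \in U by rewrite vbasis_mem // mem_nth ?size_tuple.
pose T : 'M[F]_(J + J, \dim U) :=
  col_mx (\matrix_(e, j) frob e (z j).1) (\matrix_(e, j) frob e (z j).2).
have T1 (e : 'I_J) : row (lshift J e) T = \row_j frob e (z j).1.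
  by rewrite rowKu; apply/rowP=> j; rewrite !mxE.
have T2 (e : 'I_J) : row (rshift J e) T = \row_j frob e (z j).2.
  by rewrite rowKd; apply/rowP=> j; rewrite !mxE.
pose e0 := Ordinal J0; pose eI := Ordinal IJ.
apply: (@frob_stable_rank (J + J) _ T).
  apply/row_subP=> i; rewrite -map_row -(splitK i).
  case: (split i) => e /=; rewrite ?T1 ?T2.
    have [eJ|] := ltnP e.+1 J.
      rewrite (_ : map_mx _ _ = row (lshift J (Ordinal eJ)) T) ?row_sub //.
      by rewrite T1; apply/rowP=> j; rewrite !mxE -frobD.
    move=> Je; have {Je} eJ : (1 + e)%N = J by move: (ltn_ord e); lia.
    rewrite (_ : map_mx _ _ = a1 *: row (lshift J e0) T
        + a2 *: row (lshift J eI) T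
        + a3 *: row (rshift J e0) T
        + a4 *: row (rshift J eI) T).
      by rewrite !addmx_sub ?scalemx_sub ?row_sub.
    rewrite !T1 !T2; apply/rowP=> j; rewrite !mxE -frobD eJ !frob0.
    by case: (UJ _ (zU j)).
  have [eJ|] := ltnP e.+1 J.
    rewrite (_ : map_mx _ _ = row (rshift J (Ordinal eJ)) T) ?row_sub //.
    by rewrite T2; apply/rowP=> j; rewrite !mxE -frobD.
  move=> Je; have {Je} eJ : (1 + e)%N = J by move: (ltn_ord e); lia.
  rewrite (_ : map_mx _ _ = b1 *: row (lshift J e0) T
      + b2 *: row (lshift J eI) T
      + b3 *: row (rshift J e0) T
      + b4 *: row (rshift J eI) T).
    by rewrite !addmx_sub ?scalemx_sub ?row_sub.
  rewrite !T1 !T2; apply/rowP=> j; rewrite !mxE -frobD eJ !frob0.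
  by case: (UJ _ (zU j)).
move=> u uT.
have sum0 : \sum_j u 0 j *: z j = 0.
  have rowT i : \sum_j (u 0 j)%:A * T i j = 0.
    have /rowP/(_ i) := uT; rewrite [RHS]mxE mxE => E; rewrite -[RHS]E.
    by apply: eq_bigr => j _; rewrite [map_mx _ _ _ _]mxE [T^T _ _]mxE.
  have E1 := rowT (lshift J e0); have E2 := rowT (rshift J e0).
  apply/eqP; rewrite -pair_eqE /=; apply/andP; split.
    rewrite raddf_sum /= -[X in _ == X]E1; apply/eqP/eq_bigr=> j _.
    by rewrite col_mxEu mxE frob0 mulr_algl.
  rewrite raddf_sum /= -[X in _ == X]E2; apply/eqP/eq_bigr=> j _.
  by rewrite col_mxEd mxE frob0 mulr_algl.
have /freeP := basis_free (vbasisP U).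
by move=> /(_ (u 0) sum0) u0; apply/rowP=> j; rewrite u0 mxE.
Qed.
End Moore.

Section Pairs.
Context (Fq : finFieldType) (F : fieldExtType Fq).
Local Notation m := (\dim {:F}).
Context (l : nat) (l2 : (1 < l)%N) (A : l.-tuple F).
Context (hA : forall i, tnth A i != 0) (I J : nat) (I0 : (0 < I)%N).
Context (hIJ : (I < J)%N).
Local Notation K := (J - I)%N.
Context (hkappa : ~ is_power (Ccoef #|Fq| K l) (kappa A I J)).
Local Notation form := (cform A I J).

(** Since [w'] has no [rpart], the second components are the [lpart w' k * z].
    Matching them between the axes [k] and [i] by the factor [t k] leaves
    elements [(p z, 0)] of [S], where [p] has coefficients [a k, b k, c k]. If
    these vanish for all [k], either [w] is a multiple of [w'] or [rpart w] is a
    twisted cycle. Otherwise [S] contains [(x, 0)] for all [x] in a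
    subspace of codimension at most [J], and it projects
    onto the second factor. *)
Lemma pair_forms_degenerate (w w' : 'rV[F]_(l + l))
    (S : {vspace (F * F)%type}) :
  (forall k, rpart w' k = 0) -> w' != 0 -> (forall t, w != t *: w') ->
  (forall k z, (form w k z, form w' k z) \in S) ->
  (2 * m <= \dim S + J)%N.
Proof.
move=> r0 w'0 ww' wS.
have form' k z : form w' k z = lpart w' k * z.
  by rewrite /cform /qpoly3 !r0 !mul0r !addr0.
have [i ui] : exists i, lpart w' i != 0.
  apply/existsP; apply: contraNT w'0 => /existsPn u0; apply/eqP/forms_eq0=> // k.
  exact/eqP/negbNE/u0.
pose t k := lpart w' k / lpart w' i.
pose a k := lpart w k - lpart w i * t k.
pose b k := rpart w k - rpart w i * frob I (t k).
pose c k := rpart w (ord_pred k) * tnth A k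
  - rpart w (ord_pred i) * tnth A i * frob J (t k).
have inS k z : (qpoly3 I J (a k) (b k) (c k) z, 0) \in S.
  have -> : (qpoly3 I J (a k) (b k) (c k) z, 0)
      = (form w k z, form w' k z) - (form w i (t k * z), form w' i (t k * z)).
    congr (_, _); last by rewrite /= !form' /t; field.
    by rewrite /= /cform /qpoly3 /a /b /c !rmorphM /=; ring.
  by rewrite rpredB.
have [k nz] : exists k, [|| a k != 0, b k != 0 | c k != 0].
  apply/existsP; rewrite -[[exists _, _]]negbK negb_exists; apply/negP=> /forallP all0.
  have {}all0 k : [/\ lpart w k = lpart w i * t k,
      rpart w k = rpart w i * frob I (t k)
    & rpart w (ord_pred k) * tnth A k
      = rpart w (ord_pred i) * tnth A i * frob J (t k)].
    have := all0 k; rewrite !negb_or !negbK !subr_eq0.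
    by case/and3P=> /eqP -> /eqP -> /eqP ->.
  have w0 : forall k, rpart w k = 0.
    have [bi|bi] := eqVneq (rpart w (ord_pred i)) 0 => k.
      apply: (mulIf (hA (ordS k))); rewrite -{1}(ordSK k).
      by case: (all0 (ordS k)) => _ _ ->; rewrite bi !mul0r.
    have bA : rpart w (ord_pred i) * tnth A i != 0 by rewrite mulf_neq0.
    apply: (no_twisted_cycle l2 hA hIJ hkappa
      (c := frob K (rpart w i) / (rpart w (ord_pred i) * tnth A i))) => j.
    case: (all0 j) => _ Ej Ej'.
    have JE u : frob K (frob I u) = frob J u by rewrite -frobD subnK // ltnW.
    rewrite [LHS](congr1 _ Ej) rmorphM /= JE -mulrA [tnth A j * _]mulrC Ej'.
    by rewrite mulrA divfK.
  have := ww' (lpart w i / lpart w' i); rewrite -subr_eq0 => /eqP[].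
  have lE t0 k : lpart (w - t0 *: w') k = lpart w k - t0 * lpart w' k.
    by rewrite /lpart !mxE.
  have rE t0 k : rpart (w - t0 *: w') k = rpart w k - t0 * rpart w' k.
    by rewrite /rpart !mxE.
  apply: forms_eq0 => k; rewrite ?lE ?rE; last by rewrite w0 r0 mulr0 subrr.
  by case: (all0 k) => -> _ _; rewrite /t; field.
have dS : (\dim S = \dim (S :&: lker (linfun snd)) + \dim (linfun snd @: S))%N.
  by rewrite limg_ker_dim.
have proj2 : (linfun snd @: S)%VS = fullv.
  apply/eqP; rewrite eqEsubv subvf; apply/subvP=> x _; apply/memv_imgP.
  exists (form w i (x / lpart w' i), form w' i (x / lpart w' i)) => //.
  by rewrite lfunE /= form'; field.
pose g (x : F) : F * F := (x, 0).
have g_lin : linear g.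
  by move=> e x y; rewrite /g; congr (_, _); rewrite /= scaler0 addr0.
pose gL := GRing.isLinear.Build Fq F (F * F)%type _ g g_lin.
pose gl : {linear F -> (F * F)%type} := HB.pack g gL.
have kerS : (linfun gl @: limg (linfun (qpoly3 I J (a k) (b k) (c k))) <=
    S :&: lker (linfun snd))%VS.
  apply/subvP=> _ /memv_imgP[_ /memv_imgP[x _ ->] ->].
  by rewrite !lfunE memv_cap inS memv_ker lfunE /= eqxx.
have := dim_limg_qpoly3 I0 hIJ nz.
have := dimvS kerS; rewrite limg_dim_eq; last first.
  apply/eqP; rewrite -subv0; apply/subvP=> x; rewrite memv_cap => /andP[_].
  rewrite memv_ker lfunE /= => /eqP[->]; exact: mem0v.
move=> h1 h2; rewrite dS proj2 mul2n -addnn addnAC leq_add2r.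
by rewrite (leq_trans h2) // leq_add2r.
Qed.

(** With the [rpart]s normalised to the identity at [i] and [j], the axes
    following [i] and [j] give a map of [F * F] whose kernel is a system of
    order [J] solved for its leading terms. *)
Lemma pair_forms_regular (i j : 'I_l) (w w' : 'rV[F]_(l + l))
    (S : {vspace (F * F)%type}) :
  rpart w i = 1 -> rpart w j = 0 -> rpart w' i = 0 -> rpart w' j = 1 ->
  (forall k z, (form w k z, form w' k z) \in S) ->
  (2 * m <= \dim S + 2 * J)%N.
Proof.
move=> wi wj wi' wj' wS.
pose g (z : F * F) : F * F :=
  (form w (ordS i) z.1 + form w (ordS j) z.2,
   form w' (ordS i) z.1 + form w' (ordS j) z.2).
have g_lin : linear g.
  have lin v k e (x y : F) : form v k (e *: x + y) = e *: form v k x + form v k y.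
    exact: linearP.
  move=> e x y; rewrite /g; congr (_, _); rewrite /= !lin.
    by rewrite (scalerDr e (form w _ x.1)) addrACA.
  by rewrite (scalerDr e (form w' _ x.1)) addrACA.
pose gL := GRing.isLinear.Build Fq (F * F)%type (F * F)%type _ g g_lin.
pose gl : {linear (F * F)%type -> (F * F)%type} := HB.pack g gL.
have imS : (limg (linfun gl) <= S)%VS.
  apply/subvP=> _ /memv_imgP[x _ ->]; rewrite lfunE.
  have -> : gl x = (form w (ordS i) x.1, form w' (ordS i) x.1)
    + (form w (ordS j) x.2, form w' (ordS j) x.2) by [].
  by rewrite rpredD.
have kerJ : (\dim (lker (linfun gl)) <= J + J)%N.
  pose d := - (tnth A (ordS i))^-1; pose d' := - (tnth A (ordS j))^-1.
  apply: (@dim_frob_system _ _ I J _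
    (d * lpart w (ordS i)) (d * rpart w (ordS i))
    (d * lpart w (ordS j)) (d * rpart w (ordS j))
    (d' * lpart w' (ordS i)) (d' * rpart w' (ordS i))
    (d' * lpart w' (ordS j)) (d' * rpart w' (ordS j)) hIJ) => z.
  rewrite memv_ker lfunE.
  move=> /eqP[]; rewrite /cform /qpoly3 !ordSK wi wj wi' wj' => E1 E2.
  rewrite /d /d'; split.
    apply: (mulfI (hA (ordS i))); apply/eqP; rewrite -subr_eq0; apply/eqP.
    by rewrite -[RHS]E1; field.
  apply: (mulfI (hA (ordS j))); apply/eqP; rewrite -subr_eq0; apply/eqP.
  by rewrite -[RHS]E2; field.
have dFF : \dim {:(F * F)%type} = (m + m)%N by rewrite !dimvf.
have := leq_dim_limg imS kerJ; rewrite dFF.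
by rewrite !mul2n -!addnn.
Qed.

End Pairs.

(** * Rank-metric codes and their dual systems *)
Section QMatrices.
Context (Fq : fieldType) (F : fieldExtType Fq).

Definition lift_mx p n (N : 'M[Fq]_(p, n)) : 'M[F]_(p, n) := map_mx (in_alg F) N.

Lemma colspan_combination k n (G : 'M[F]_(k, n)) (a : 'I_n -> Fq) :
  (\sum_j a j *: (columns G)`_j : 'rV[F]_k)^T = G *m lift_mx (\col_j a j).
Proof.
apply/colP=> i; rewrite mxE [LHS]summxE [RHS]mxE; apply: eq_bigr => j _.
rewrite [LHS]qvec_scaleE -tnth_nth tnth_mktuple !mxE.
by rewrite mulr_algr.
Qed.

Lemma mem_colspan k n (G : 'M[F]_(k, n)) (v : qvec F k) :
  v \in colspan G -> exists a : 'cV[Fq]_n, v^T = G *m lift_mx a.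
Proof.
move/coord_span=> vE; exists (\col_j coord (columns G) j v).
by rewrite -colspan_combination -vE.
Qed.

Lemma mem_columns k n (G : 'M[F]_(k, n)) j : (col j G)^T \in colspan G.
Proof.
by apply: memv_span; rewrite -[X in X \in _](tnth_mktuple (fun j => (col j G)^T)) mem_tnth.
Qed.

Lemma free_columnsP k n (G : 'M[F]_(k, n)) :
  free (columns G) <-> (forall a : 'cV[Fq]_n, G *m lift_mx a = 0 -> a = 0).
Proof.
split=> [/freeP fG a Ga | inj].
  have Ea : a = \col_j a j 0 by apply/colP=> j; rewrite mxE.
  apply/colP=> j; rewrite mxE.
  apply: (fG (fun j => a j 0)); apply: trmx_inj.
  by rewrite colspan_combination -Ea Ga trmx0.
apply/freeP=> a Sa j; have := colspan_combination G a.
rewrite Sa trmx0 => /esym/inj /colP/(_ j).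
by rewrite !mxE.
Qed.

Lemma sub_Fspan k (U : {vspace qvec F k}) (v : qvec F k) :
  v \in U -> ((v : 'rV[F]_k) <= Fspan U)%MS.
Proof.
move=> vU; have vE := coord_vbasis vU.
have -> : (v : 'rV[F]_k)
    = \sum_i (coord (vbasis U) i v)%:A *: (row i (Fspan U) : 'rV[F]_k).
  rewrite {1}vE; apply: eq_bigr => i _; congr (_ *: _).
  by apply/rowP=> j; rewrite !mxE (tnth_nth 0).
by apply: summx_sub => i _; rewrite scalemx_sub ?row_sub.
Qed.

Lemma row_full_colspan r n (G : 'M[F]_(r, n)) :
  row_free G -> row_full (Fspan (colspan G)).
Proof.
move=> Gfree; rewrite -sub1mx.
have GU : (G^T <= Fspan (colspan G))%MS.
  apply/row_subP=> j; rewrite -tr_col; apply: sub_Fspan; exact: mem_columns.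
by apply: submx_trans GU; rewrite sub1mx /row_full mxrank_tr.
Qed.

(** A word has rank weight at most [t] exactly when it factors through a matrix
    with [t] rows over the base field. Stated with factorisations, the bound on
    the minimum distance needs no basis of the span of the coordinates. *)
Definition dist_ge p n (H : 'M[F]_(p, n)) (d : nat) : Prop :=
  forall (w : 'rV[F]_p) t (X : 'rV[F]_t) (N : 'M[Fq]_(t, n)),
    w != 0 -> w *m H = X *m lift_mx N -> (d <= t)%N.

Section Dual.
Context p n r (H : 'M[F]_(p, n)) (G : 'M[F]_(r, n)).
Context (hG : is_generator G (dual_code H)).

Lemma generator_mul0 : H *m G^T = 0.
Proof.
case/andP: hG => _ /andP[/sub_kermxP GH _]; apply: trmx_inj.
by rewrite trmx_mul trmxK GH trmx0.
Qed.

Lemma generator_rank : (r + \rank H = n)%N.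
Proof.
case/andP: hG => /eqP Gr /eqmxP GH; rewrite -{1}Gr GH.
by rewrite mxrank_ker mxrank_tr subnK ?rank_leq_col.
Qed.

Lemma dual_generator : (H :=: dual_code G)%MS.
Proof.
apply/eqmxP; rewrite -(geq_leqif (mxrank_leqif_eq _)); last first.
  by apply/sub_kermxP; exact: generator_mul0.
rewrite mxrank_ker mxrank_tr; case/andP: hG => /eqP -> _.
by have := generator_rank; lia.
Qed.

Lemma dual_wordP (y : 'rV[F]_n) : G *m y^T = 0 -> exists w, y = w *m H.
Proof.
move=> Gy; apply/submxP; rewrite dual_generator; apply/sub_kermxP.
by apply: trmx_inj; rewrite trmx_mul trmxK Gy trmx0.
Qed.

(** A relation over the base field between the columns of [G] is a word of the
    code of [H] of weight one. *)
Lemma dist_ge_free : dist_ge H 2 -> free (columns G).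
Proof.
move=> dH; apply/free_columnsP=> a Ga.
have [] := @dual_wordP (lift_mx a)^T; first by rewrite trmxK.
move=> w wE; apply/eqP; have [w0|w0] := eqVneq w 0.
  move: wE; rewrite w0 mul0mx -[RHS]trmx0 => /trmx_inj.
  by move/eqP; rewrite map_mx_eq0.
have E : w *m H = 1%:M *m lift_mx a^T by rewrite mul1mx -wE /lift_mx map_trmx.
by have := dH _ _ _ _ w0 E.
Qed.

(** If [h + 1] independent elements [G a_i] of the system lie in an
    [h]-dimensional [F]-space, an [F]-combination of the [a_i] is killed by
    [G], hence is a nonzero word of the code of [H] of weight at most [h + 1]. *)
Lemma dist_ge_scattered h : dist_ge H h.+2 -> scattered h (colspan G).
Proof.
move=> dH Hh rH; rewrite leqNgt; apply/negP=> hU.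
set U := (colspan G :&: resv Hh)%VS in hU.
pose us := take h.+1 (vbasis U).
have us_size : size us == h.+1 by rewrite size_takel // size_tuple.
have us_free : free (Tuple us_size).
  have := basis_free (vbasisP U).
  by rewrite -[X in free X](cat_take_drop h.+1) => /catl_free.
pose u (i : 'I_h.+1) : 'rV[F]_r := us`_i.
have uU i : (u i \in colspan G) && (u i \in resv Hh).
  by rewrite -memv_cap; apply/vbasis_mem/(@mem_take h.+1)/mem_nth; rewrite (eqP us_size).
have [a aE] : exists a : 'I_h.+1 -> 'cV[Fq]_n, forall i, (u i)^T = G *m lift_mx (a i).
  apply: (fin_all_exists
    (P := fun i (b : 'cV[Fq]_n) => (u i)^T = G *m lift_mx b)) => i.
  apply: mem_colspan.
  by case/andP: (uU i).
pose M : 'M[F]_(h.+1, r) := \matrix_i u i.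
pose N : 'M[Fq]_(h.+1, n) := \matrix_i (a i)^T.
have MN : M = lift_mx N *m G^T.
  apply/row_matrixP=> i; rewrite rowK row_mul; apply: trmx_inj.
  rewrite aE trmx_mul trmxK; congr (_ *m _).
  by apply/colP=> j; rewrite !mxE.
have Mrank : (\rank M <= h)%N.
  rewrite -[X in (_ <= X)%N]rH; apply/mxrankS/row_subP=> i; rewrite rowK -mem_resv.
  by case/andP: (uU i).
have /rowV0Pn[c /sub_kermxP cM c0] : kermx M != 0.
  by rewrite kermx_eq0 /row_free neq_ltn ltnS Mrank.
have [] := @dual_wordP (c *m lift_mx N).
  by apply: trmx_inj; rewrite trmx_mul trmxK -mulmxA -MN cM trmx0.
move=> w wE; have [w0|w0] := eqVneq w 0; last first.
  by have := dH _ _ _ _ w0 (esym wE); rewrite ltnn.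
have Nfree : row_free N.
  rewrite -kermx_eq0; apply/eqP/row_matrixP=> k; rewrite row0.
  have kN : row k (kermx N) *m N = 0 by rewrite -row_mul mulmx_ker row0.
  move: (row k _) kN => e eN.
  have sum0 : \sum_(i < h.+1) e 0 i *: (Tuple us_size)`_i = 0.
    transitivity (lift_mx e *m M); last by rewrite MN mulmxA -map_mxM eN map_mx0 mul0mx.
    apply/rowP=> j; rewrite [LHS]summxE mxE; apply: eq_bigr => i _.
    by rewrite [LHS]qvec_scaleE !mxE mulr_algl.
  by move/freeP/(_ _ sum0): us_free => e0; apply/rowP=> i; rewrite e0 mxE.
move: wE; rewrite w0 mul0mx => /eqP; rewrite mulmx_free_eq0 ?(negPf c0) //.
by rewrite /row_free mxrank_map.
Qed.

End Dual.
End QMatrices.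

(** * The second generalised weight and equivalence *)
Section SecondWeight.
Context (Fq : finFieldType) (F : fieldExtType Fq).

(** A lower bound on the second generalised rank weight. A subcode whose support
    has dimension [t] factors through [t] rows over the base field; in this form
    the bound is visibly invariant under base-field changes of coordinates and
    under field automorphisms. *)
Definition d2_ge p n (H : 'M[F]_(p, n)) (d : nat) : Prop :=
  forall (Q : 'M[F]_(2, p)) t (X : 'M[F]_(2, t)) (N : 'M[Fq]_(t, n)),
    row_free Q -> Q *m H = X *m lift_mx F N -> (d <= t)%N.

Lemma d2_ge_subcode p n (H : 'M[F]_(p, n)) d k (V : 'M[F]_(k, n)) t
    (X : 'M[F]_(k, t)) (N : 'M[Fq]_(t, n)) :
  d2_ge H d -> (V <= H)%MS -> \rank V = 2%N -> V = X *m lift_mx F N -> (d <= t)%N.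
Proof.
move=> dH /submxP[W VW] rV VX.
have [Q Qfree /submxP[R QR]] : exists2 Q : 'M[F]_(2, n), row_free Q & (Q <= V)%MS.
  by rewrite -rV; exists (row_base V); rewrite ?row_base_free ?eq_row_base.
apply: (dH (R *m W) t (R *m X) N); last by rewrite -!mulmxA -VX -VW.
move: Qfree; rewrite /row_free QR VW mulmxA !eqn_leq !rank_leq_row /=.
by move/leq_trans; apply; exact: mxrankM_maxl.
Qed.

Lemma expandK n (x : 'rV[F]_n) :
  x = (\row_i (vbasis {:F})`_i) *m lift_mx F (expand x).
Proof.
apply/rowP=> j; rewrite mxE [LHS](coord_vbasis (memvf _)).
by apply: eq_bigr => i _; rewrite !mxE mulr_algr.
Qed.

Lemma Rsupp_factor p n (V : 'M[F]_(p, n)) :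
  (row_base V <= lift_mx F (row_base (Rsupp V)))%MS.
Proof.
apply/row_subP=> i; rewrite [row i _]expandK.
have /submxP[C ->] : (expand (row i (row_base V)) <= row_base (Rsupp V))%MS.
  by rewrite eq_row_base (sumsmx_sup i) // genmxE.
by rewrite /lift_mx map_mxM mulmxA submxMl.
Qed.

Lemma d2_ge_Rsupp p n (H : 'M[F]_(p, n)) d (V : 'M[F]_n) :
  d2_ge H d -> (V <= H)%MS -> \rank V = 2%N -> (d <= \rank (Rsupp V))%N.
Proof.
move=> dH VH rV; have /submxP[X E] := Rsupp_factor V.
by apply: (d2_ge_subcode dH _ _ E); rewrite eq_row_base.
Qed.

(** The support dimensions form a decidable set of numbers, as [F] is finite;
    [finvect_type] provides the finite structure on [F]. *)
Lemma is_d2_exists p n (H : 'M[F]_(p, n)) d :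
  (1 < p)%N -> row_free H -> d2_ge H d -> exists2 w, is_d2 H w & (d <= w)%N.
Proof.
move=> p1 Hfree dH.
pose P e := [exists V : 'M[finvect_type F]_n,
  [&& ((V : 'M[F]_n) <= H)%MS, \rank (V : 'M[F]_n) == 2%N
    & \rank (Rsupp (V : 'M[F]_n)) == e]].
pose V0 : 'M[F]_n := <<(pid_mx 2 : 'M[F]_p) *m H>>%MS.
have V0H : (V0 <= H)%MS by rewrite genmxE submxMl.
have rV0 : \rank V0 = 2%N.
  by rewrite mxrank_gen mxrankMfree // rank_pid_mx.
have exP : exists e, P e.
  exists (\rank (Rsupp V0)); apply/existsP; exists V0.
  by apply/and3P; split=> //; apply/eqP.
have [w /existsP[V /and3P[VH /eqP rV /eqP rw]] wmin] := ex_minnP exP.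
exists w; last by rewrite -rw; exact: d2_ge_Rsupp dH VH rV.
split; first by exists V.
move=> e [V' [V'H rV' re]]; apply: wmin; apply/existsP; exists V'.
by apply/and3P; split=> //; apply/eqP.
Qed.

(** Automorphisms of [F] need not fix the base field, but they preserve it, as
    it is the set of solutions of [x ^ q = x]. *)
Lemma rmorph_lift (sigma : {rmorphism F -> F}) p n (N : 'M[Fq]_(p, n)) :
  exists N', map_mx sigma (lift_mx F N) = lift_mx F N'.
Proof.
exists (map_mx (@qcoord Fq F) (map_mx sigma (lift_mx F N))).
apply/matrixP=> i j; rewrite ![in LHS]mxE ![in RHS]mxE; apply: qcoordE.
by rewrite /frob expn1 -!rmorphXn /= expf_card.
Qed.

Lemma rmorph_unlift (sigma : {rmorphism F -> F}) p n (N : 'M[F]_(p, n))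
    (N' : 'M[Fq]_(p, n)) :
  map_mx sigma N = lift_mx F N' -> exists N0, N = lift_mx F N0.
Proof.
move=> E; exists (map_mx (@qcoord Fq F) N); apply/matrixP=> i j.
rewrite ![in RHS]mxE; apply: qcoordE; apply: (fmorph_inj sigma).
have sE : sigma (N i j) = (N' i j)%:A.
  by have := congr1 (fun A : 'M[F]_(p, n) => A i j) E; rewrite !mxE.
by rewrite /frob expn1 rmorphXn /= sE -in_algE -rmorphXn /= expf_card.
Qed.

(** The equivalence gives an invertible [M] and a base-field matrix [P] with
    [G' = M sigma(G P)], where [G'] generates the dual of [D]. Pulling [E] back
    along [sigma] and multiplying by the transpose of [P] lands in the code of
    [H], keeps the rank, and keeps the number of rows of the factorisation. *)
Lemma equiv_d2_le p n r n' k (H : 'M[F]_(p, n)) (G : 'M[F]_(r, n)) d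
    (D : 'M[F]_n') (U' : {vspace qvec F r})
    (E : 'M[F]_(k, n')) t (X : 'M[F]_(k, t)) (N : 'M[Fq]_(t, n')) :
  is_generator G (dual_code H) -> d2_ge H d ->
  associated (dual_code D) U' -> system_equiv (colspan G) U' ->
  (E <= D)%MS -> \rank E = 2%N -> E = X *m lift_mx F N -> (d <= t)%N.
Proof.
move=> hG dH [ndD [G' hG' ->]] [M [sigma [Munit [g sK gK] UU']]] ED rE EX.
have G'inj (a : 'cV[Fq]_n') : G' *m lift_mx F a = 0 -> a = 0.
  move=> G'a; have /free_columnsP := ndD; apply.
  have /submxP[S ->] : (row_base (dual_code D) <= G')%MS.
    by rewrite eq_row_base; case/andP: hG' => _ /andP[].
  by rewrite -mulmxA G'a mulmx0.
have [P0 P0E] : exists P0 : 'I_n' -> 'cV[Fq]_n, forall j,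
    col j G' = M *m map_mx sigma (G *m lift_mx F (P0 j)).
  apply: (fin_all_exists (P := fun j (b : 'cV[Fq]_n) =>
    col j G' = M *m map_mx sigma (G *m lift_mx F b))) => j.
  have /UU'[u /mem_colspan[b ub] uE] := mem_columns G' j.
  exists b; rewrite -ub; apply: trmx_inj.
  by rewrite uE trmx_mul -map_trmx trmxK.
pose P : 'M[Fq]_(n, n') := \matrix_(i, j) P0 j i 0.
have PE : G' = M *m map_mx sigma (G *m lift_mx F P).
  apply/matrixP=> i j; have /colP/(_ i) := P0E j; rewrite mxE => ->.
  have -> : P0 j = col j P by apply/colP=> i'; rewrite !mxE.
  rewrite colE /lift_mx [map_mx _ (P *m _)]map_mxM map_delta_mx mulmxA map_mxM map_delta_mx mulmxA.
  by rewrite -colE mxE.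
have Pfree : row_free P^T.
  rewrite -kermx_eq0; apply/eqP/row_matrixP=> i; rewrite row0.
  have : row i (kermx P^T) *m P^T = 0 by rewrite -row_mul mulmx_ker row0.
  move: (row i _) => e eP; have [e' eE] := rmorph_lift sigma e^T.
  have e'0 : e' = 0.
    apply: G'inj; rewrite PE -eE -mulmxA -map_mxM -mulmxA -map_mxM.
    by rewrite -[P]trmxK -trmx_mul eP trmx0 !map_mx0 mulmx0 map_mx0 mulmx0.
  apply: trmx_inj; apply/eqP; rewrite trmx0.
  by move/eqP: eE; rewrite e'0 /lift_mx map_mx0 !map_mx_eq0.
have unmap a b (B : 'M[F]_(a, b)) : B = map_mx sigma (map_mx g B).
  by apply/matrixP=> i j; rewrite !mxE gK.
have [N0 N0E] : exists N0, map_mx g (lift_mx F N) = lift_mx F N0.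
  by apply: (@rmorph_unlift sigma _ _ _ N); rewrite -unmap.
pose E0 := map_mx g E; pose X0 := map_mx g X.
have E0X : E0 = X0 *m lift_mx F N0.
  by apply: (map_mx_inj (f := sigma)); rewrite map_mxM -N0E -!unmap.
have rE0 : \rank E0 = 2%N by rewrite -(mxrank_map sigma) -unmap.
apply: (@d2_ge_subcode p n H d k (E0 *m lift_mx F P^T) t X0 (N0 *m P^T)) => //.
- rewrite (dual_generator hG); apply/sub_kermxP.
  have G'E : G' *m E^T = 0.
    have := generator_mul0 hG'; case/submxP: ED => Z ->.
    move/(congr1 trmx); rewrite trmx_mul trmxK trmx0 => G'D.
    by rewrite trmx_mul mulmxA G'D mul0mx.
  apply: trmx_inj; rewrite !trmx_mul trmx0 trmxK /lift_mx map_trmx trmxK mulmxA.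
  apply: (map_mx_inj (f := sigma)); apply: (can_inj (mulKmx Munit)).
  by rewrite map_mxM map_mx0 mulmx0 mulmxA -PE -map_trmx -unmap.
- by rewrite mxrankMfree // /row_free mxrank_map.
- by rewrite E0X -mulmxA -map_mxM.
Qed.

Lemma direct_sum_block l (s : 'I_l -> nat) (Ds : forall i, 'M[F]_(s i)) i :
  exists2 N : 'M[Fq]_(s i, \sum_i s i), row_free N
    & (Ds i *m lift_mx F N <= \mxdiag_i Ds i)%MS.
Proof.
pose N : 'M[Fq]_(s i, \sum_i s i) := submxcol 1%:M i.
exists N.
  rewrite -kermx_eq0; apply/eqP/row_matrixP=> k; rewrite row0.
  have : row k (kermx N) *m N = 0 by rewrite -row_mul mulmx_ker row0.
  move/(congr1 (fun B => submxrow B i)); rewrite submxrow0 -mul_submxrow.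
  by rewrite /N -submxblockEv -mxdiagZ /mxdiag mxblockK eqxx conform_mx_id mulmx1.
have -> : Ds i *m lift_mx F N = submxcol (\mxdiag_i Ds i) i.
  rewrite -[\mxdiag_i _ in RHS]mulmx1 -[1%:M in RHS]submxcolK mul_mxdiag_mxcol mxcolK.
  congr (_ *m _); apply/matrixP=> a b; rewrite !mxE.
  by case: eqP; rewrite ?rmorph1 ?rmorph0.
by apply/row_subP=> k; rewrite row_rowsub row_sub.
Qed.

End SecondWeight.

(** * The code of the cyclic family *)
Section CyclicCode.
Context (Fq : finFieldType) (F : fieldExtType Fq).
Local Notation m := (\dim {:F}).
Context (l : nat) (l2 : (1 < l)%N) (A : l.-tuple F).
Context (hA : forall i, tnth A i != 0) (I J : nat) (I0 : (0 < I)%N).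
Context (hIJ : (I < J)%N) (hJ : (J < m)%N) (hcop : coprime I J).
Local Notation K := (J - I)%N.
Context (hkappa : ~ is_power (Ccoef #|Fq| K l) (kappa A I J)).
Local Notation form := (cform A I J).
Context (n0 s : nat) (H0 : 'M[F]_(l + l, n0)) (hH0 : basis_of (WA A I J) (columns H0)).
Context (Z : 'M[F]_(l + l, s)).
Local Notation H := (row_mx H0 Z).

Lemma factor_WA p t (Q : 'M[F]_(p, l + l)) (X : 'M[F]_(p, t))
    (N : 'M[Fq]_(t, n0 + s)) (x : qvec F l) :
  Q *m H = X *m lift_mx F N ->
  exists a : 'cV[Fq]_t, Q *m (WA_map A I J x)^T = X *m lift_mx F a.
Proof.
rewrite mul_mx_row => /(congr1 lsubmx); rewrite row_mxKl => QH.
have /mem_colspan[b ->] : (WA_map A I J x : qvec F (l + l)) \in colspan H0.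
  by rewrite /colspan (span_basis hH0) -lfunE memv_img ?memvf.
exists (lsubmx N *m b); rewrite mulmxA QH /lift_mx map_mxM mulmxA.
congr (_ *m _); rewrite -[in LHS](hsubmxK N) map_row_mx mul_mx_row.
by rewrite row_mxKl.
Qed.

(** One family [a] of base-field coefficients serves all functionals [r]: this
    is what puts the pairs of values of two forms in a common space of dimension
    at most [t]. *)
Lemma cform_factor p t (Q : 'M[F]_(p, l + l)) (X : 'M[F]_(p, t))
    (N : 'M[Fq]_(t, n0 + s)) k z :
  Q *m H = X *m lift_mx F N -> exists a : 'I_t -> Fq,
    forall r : 'rV[F]_p, form (r *m Q) k z = \sum_i a i *: (r *m X) 0 i.
Proof.
move=> E; have [a aE] := factor_WA (z *: delta_mx 0 k : 'rV[F]_l) E.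
exists (a^~ 0) => r; rewrite -cformE -mulmxA aE mulmxA mxE.
by apply: eq_bigr => i _; rewrite [lift_mx _ _ _ _]mxE mulr_algr.
Qed.

Lemma cyclic_code_dist : dist_ge H m.-1.
Proof.
move=> w t X N w0 E; pose S := <<[tuple X 0%R i | i < t]>>%VS.
have St : (\dim S <= t)%N by rewrite (leq_trans (dim_span _)) ?size_tuple.
suff : (m <= (\dim S).+1)%N by move: St; lia.
apply: (cyclic_forms_span l2 hA I0 hIJ hJ hcop hkappa w0) => k z.
have [a aE] := cform_factor k z E.
have := aE 1%:M; rewrite !mul1mx => ->.
apply: rpred_sum => i _; apply/rpredZ/memv_span.
by rewrite -[X in X \in _](tnth_mktuple (fun i => X 0 i)) mem_tnth.
Qed.

Lemma cyclic_code_free : (1 < m)%N -> row_free H.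
Proof.
move=> m1; rewrite -kermx_eq0; apply/rowV0P=> w /sub_kermxP wH.
apply/eqP/negPn/negP=> w0.
have E : w *m H = 0 *m lift_mx F (0 : 'M[Fq]_(0, _)) by rewrite wH mul0mx.
by have := cyclic_code_dist w0 E; lia.
Qed.

(** The two cases are the rank of the [rpart]s of the two functionals. For rank
    two an invertible 2 x 2 minor is moved to the identity; for smaller rank
    some combination [r'] kills the [rpart]s, and [r] completes it to a
    basis. *)
Lemma cyclic_code_d2 : d2_ge H (2 * m - 2 * J).
Proof.
move=> Q t X N Qfree E; rewrite leq_subLR addnC.
have span (r r' : 'rV[F]_2) : exists2 S : {vspace (F * F)%type},
    (\dim S <= t)%N
    & forall k z, (form (r *m Q) k z, form (r' *m Q) k z) \in S.
  pose S := <<[tuple ((r *m X) 0 i, (r' *m X) 0 i)%R | i < t]>>%VS.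
  exists S; first by rewrite (leq_trans (dim_span _)) ?size_tuple.
  move=> k z; have [a aE] := cform_factor k z E.
  rewrite !aE.
  have -> : (\sum_i a i *: (r *m X) 0 i, \sum_i a i *: (r' *m X) 0 i)
      = \sum_i a i *: ((r *m X) 0 i, (r' *m X) 0 i).
    by apply/eqP; rewrite -pair_eqE /= !raddf_sum /= !eqxx.
  apply: rpred_sum => i _; apply/rpredZ/memv_span.
  by rewrite -[X in X \in _](tnth_mktuple
    (fun i => ((r *m X) 0 i, (r' *m X) 0 i))) mem_tnth.
have [Rfree|] := boolP (row_free (rsubmx Q)).
  have Rfull : row_full (rsubmx Q)^T by rewrite /row_full mxrank_tr.
  pose f := fullrankfun Rfull.
  pose M := rowsub f (rsubmx Q)^T.
  have Munit : M \in unitmx by rewrite -row_full_unit fullrowsub_full.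
  have rE i j : rpart (row i (invmx M^T) *m Q) (f j) = (i == j)%:R.
    transitivity ((invmx M^T *m M^T) i j); last first.
      by rewrite mulVmx ?unitmx_tr // mxE.
    rewrite /rpart !mxE; apply: eq_bigr => k _; by rewrite !mxE.
  have [S St Sform] := span (row 0 (invmx M^T)) (row 1 (invmx M^T)).
  have := pair_forms_regular hA hIJ
    (rE 0 0) (rE 0 1) (rE 1 0) (rE 1 1) Sform.
  by move/leq_trans; apply; rewrite leq_add2r.
rewrite -kermx_eq0 => /rowV0Pn[r' /sub_kermxP r'R r'0].
have [r rr'] : exists r : 'rV[F]_2, ~~ (r <= r')%MS.
  have /row_subPn[i ri] : ~~ ((1%:M : 'M[F]_2) <= r')%MS.
    apply/negP=> /mxrankS; rewrite mxrank1 => /leq_trans/(_ (rank_leq_row _)).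
    by [].
  by exists (row i 1%:M).
have [S St Sform] := span r r'.
suff : (2 * m <= \dim S + J)%N.
  by move/leq_trans; apply; rewrite leq_add // leq_pmull.
apply: (pair_forms_degenerate l2 hA I0 hIJ hkappa _ _ _ Sform).
- by move=> k; have /rowP/(_ k) := r'R; rewrite mulmx_rsub /rpart !mxE.
- by rewrite mulmx_free_eq0.
- move=> c; apply: contraNneq rr'; rewrite scalemxAl => /(row_free_inj Qfree) ->.
  by rewrite scalemx_sub.
Qed.

End CyclicCode.

Lemma extremal_length (l m s : nat) : (2 * s < m - 2)%N ->
  (l * m + s = ((l * (m - 2) + s) * m) %/ (m - 2))%N.
Proof.
move=> sm; have m2 : m = (m - 2 + 2)%N by lia.
move: (m - 2)%N m2 sm => k -> sk.
rewrite (_ : (l * k + s) * (k + 2) = (l * (k + 2) + s) * k + 2 * s)%N; last by lia.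
by rewrite divnMDl ?divn_small ?addn0 //; lia.
Qed.

Theorem corollary5p1
  (Fq : finFieldType) (F : fieldExtType Fq) (q m : nat)
  (hq : #|Fq| = q) (hm : \dim {:F} = m) (hm5 : (5 <= m)%N)
  (l : nat) (hl : (3 <= l)%N)
  (A : l.-tuple F) (hA : forall i, tnth A i != 0)
  (I J : nat) (hI : (0 < I)%N) (hIJ : (I < J)%N) (hJ : (J < m)%N)
  (hcop : coprime I J)
  (K : nat) (hK : K = (J - I)%N)
  (hkappa : ~ is_power (Ccoef q K l) (kappa A I J))
  (hPi : exists delta : nat, [/\ (1 <= delta)%N, (delta <= l - 1)%N
     & ~ is_power (q ^ (l * K) - 1) (Pi A I J (delta + 2) / Pi A I J 2)])
  (s : nat) (hs1 : (1 <= s)%N) (hs : (2 * s < m - 2)%N)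
  (B : {vspace F}) (hB : \dim B = s)
  (b : s.-tuple F) (hb : basis_of B b)
  (H0 : 'M[F]_(l + l, l * m)) (hH0 : basis_of (WA A I J) (columns H0))
  (r : nat) (G : 'M[F]_(r, l * m + s))
  (hG : is_generator G (dual_code (HAB H0 b))) :
  [/\ [/\ r = (l * (m - 2) + s)%N,
          is_qsystem (l * m + s) (colspan G)
        & extremal_scattered (m - 3) (colspan G)],
      (* D is the row space of H_{A,B}; its dual is the row space of G *)
      associated G (colspan G) /\ (HAB H0 b :=: dual_code G)%MS,
      exists2 w : nat, is_d2 (HAB H0 b) w & (2 * m - 2 * J <= w)%N
    & (s %/ l < m - 2 * J)%N ->
      forall sv : 'I_l -> nat, (\sum_(i < l) sv i)%N = s ->
      forall D : 'M[F]_(\sum_(i < l) (\dim {:F} + sv i)),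
        order_one_direct_sum D ->
      forall U' : {vspace qvec F r},
        associated (dual_code D) U' -> ~ system_equiv (colspan G) U'].
Proof.
have l2 : (1 < l)%N by apply: ltn_trans hl.
subst q K; subst m; set m := \dim {:F} in hm5 hJ hs H0 hH0 G hG *.
have Hfree : row_free (HAB H0 b).
  by apply: (cyclic_code_free l2 hA hI hIJ hJ hcop hkappa hH0); lia.
have Hdist : dist_ge (HAB H0 b) m.-1.
  exact: (cyclic_code_dist l2 hA hI hIJ hJ hcop hkappa hH0).
have Hd2 : d2_ge (HAB H0 b) (2 * m - 2 * J).
  exact: (cyclic_code_d2 l2 hA hI hIJ hkappa hH0).
have rE : r = (l * (m - 2) + s)%N.
  have := generator_rank hG; rewrite (eqP Hfree); nia.
have Gfree : free (columns G).
  by apply: (dist_ge_free hG) => w t X N w0 E; have := Hdist w t X N w0 E; lia.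
have Gdim : \dim (colspan G) = (l * m + s)%N.
  by rewrite (eqP Gfree) size_tuple.
have Grow : row_free G by case/andP: hG.
have GG : is_generator G G by rewrite /is_generator Grow submx_refl.
split.
- split=> //; first by split=> //; exact: row_full_colspan.
  split.
    apply: (dist_ge_scattered hG) => w t X N w0 E.
    by have := Hdist w t X N w0 E; lia.
  rewrite Gdim rE (_ : m - 3 + 1 = m - 2)%N; last by lia.
  exact: extremal_length.
- split; last exact: dual_generator.
  split; last by exists G.
  apply/free_columnsP=> a Ga; move/free_columnsP: Gfree; apply.
  have /submxP[S ->] : (G <= row_base G)%MS by rewrite eq_row_base.
  by rewrite -mulmxA Ga mulmx0.
- by apply: is_d2_exists => //; lia.
move=> sl sv sumsv D [Ds hDs hD] U' aU' eU'.
(* the smallest entry of [sv] is at most the average *)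
have [i svi] : exists i, (sv i <= s %/ l)%N.
  apply/existsP; apply: contraLR (leqnn s) => /existsPn big.
  rewrite -ltnNge -{2}sumsv.
  have : (\sum_(i < l) (s %/ l).+1 <= \sum_(i < l) sv i)%N.
    by apply: leq_sum => i _; rewrite ltnNge big.
  rewrite sum_nat_const card_ord; apply: leq_trans.
  by rewrite mulnC -ltn_divLR // (ltn_trans _ l2).
have [N Nfree NE] := direct_sum_block Ds i.
have rE2 : \rank (Ds i *m lift_mx F N) = 2%N.
  rewrite mxrankMfree ?/row_free ?mxrank_map //.
  by have [_ []] := hDs i.
have ED : (Ds i *m lift_mx F N <= D)%MS by rewrite hD.
have := equiv_d2_le hG Hd2 aU' eU' ED rE2 erefl.
rewrite -/m; apply/negP; rewrite -ltnNge.
by have := leq_ltn_trans svi sl; clear; lia.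
Qed.
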